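(* Let $G$ be the fundamental group of a finite reduced graph of groups $\Gamma$, with $G$ finitely generated. Assume that $\Gamma$ is not an ascending HNN-extension. Let $\varphi:G\to\mathbb{R}$ be a nonzero homomorphism. (i) If all edge groups of $\Gamma$ are in $\varsigma$, then $[\varphi]\in\Sigma(G)$ if and only if $\varphi$ is non-trivial on every edge group and $[\varphi_{|G_v}]\in\Sigma(G_v)$ for every vertex group $G_v$. (ii) If all vertex groups of $\Gamma$ are in $\varsigma$, then $[\varphi]\in\Sigma(G)$ if and only if $\varphi$ is non-trivial on every edge group. In particular, $\Sigma(G)=-\Sigma(G)$ is the complement in $S(G)$ of a finite number of rationally defined subspheres.
   Context: For a finitely generated group $G$, $S(G)$ is the sphere of classes $[\varphi]$ of nonzero homomorphisms $\varphi:G\to\mathbb{R}$, where $[\varphi]=[\psi]$ iff $\varphi=\lambda\psi$ for some real $\lambda>0$. For a finite generating set $\mathcal{G}$ of $G$, $\mathrm{Cay}(G,\mathcal{G})$ is the Cayley graph with vertex set $G$ and edges joining $g$ to $gs$ for $s\in\mathcal{G}$, and $\mathrm{Cay}(G,\mathcal{G})^{[0,\infty)}$ is its induced subgraph on $\{g:\varphi(g)\ge0\}$. The Bieri-Neumann-Strebel (BNS) invariant $\Sigma(G)\subset S(G)$ is the set of $[\varphi]$ such that $\mathrm{Cay}(G,\mathcal{G})^{[0,\infty)}$ is connected for some (equivalently every) finite generating set $\mathcal{G}$. For $X\subset S(G)$, $-X=\{[-\varphi]:[\varphi]\in X\}$. The statement $[\varphi_{|H}]\in\Sigma(H)$ includes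 the requirement that $\varphi_{|H}\ne0$. A subsphere is rationally defined if it is the set of classes of nonzero elements of a linear subspace of $\mathrm{Hom}(G,\mathbb{R})$ defined over $\mathbb{Q}$. $\varsigma$ is the class of finitely generated groups $H$ with $\Sigma(H)=S(H)$ (equivalently, with $[H,H]$ finitely generated). Edge groups $G_e$ and vertex groups $G_v$ are regarded as subgroups of $G$ (well defined up to conjugacy). A graph of groups is reduced if, for every edge $e$ with distinct endpoints $v_1,v_2$, the inclusions $G_e\hookrightarrow G_{v_1}$ and $G_e\hookrightarrow G_{v_2}$ are proper. ''$\Gamma$ is not an ascending HNN-extension'' means: either $\Gamma$ is not an HNN-extension (i.e. $\Gamma$ does not consist of a single vertex with a single loop), or it is an HNN-extension $\langle G_1,t\mid t^{-1}at=\sigma(a),\ a\in A\rangle$ in which both $A$ and $\sigma(A)$ are proper subgroups of $G_1$. In (i), vertex groups are automatically finitely generated, so $\Sigma(G_v)$ is defined. *)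

(* Defs.v *)
From HB Require Import structures.
From mathcomp Require Import all_boot all_order all_algebra.
From mathcomp Require Import boolp classical_sets reals.

Set Implicit Arguments.
Unset Strict Implicit.
Unset Printing Implicit Defensive.

Import GRing.Theory Num.Theory.
Local Open Scope classical_set_scope.
Local Open Scope ring_scope.

(* A finite graph is given by one orientation [src, tgt] of each edge;
   multiple edges and loops are allowed. *)
Record graph_of_groups := GraphOfGroups {
  vertex : finType;
  edge : finType;
  src : edge -> vertex;
  tgt : edge -> vertex;
  vgroup : vertex -> groupType;
  egroup : edge -> groupType;
  esrc : forall e, {multiplicative egroup e -> vgroup (src e)};
  etgt : forall e, {multiplicative egroup e -> vgroup (tgt e)};
  esrc_inj : forall e, injective (esrc e);
  etgt_inj : forall e, injective (etgt e)
}.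

Section GraphOfGroups.
Variable GG : graph_of_groups.

(* [(e, false)] is [e] travelled from [src e] to [tgt e], and [(e, true)] is
   the reverse edge. *)
Definition oedge : Type := edge GG * bool.
HB.instance Definition _ := Finite.on oedge.
Definition oorig (a : oedge) := if a.2 then tgt a.1 else src a.1.
Definition oterm (a : oedge) := if a.2 then src a.1 else tgt a.1.
Definition orev (a : oedge) : oedge := (a.1, ~~ a.2).

Fixpoint edge_path (u : vertex GG) (p : seq oedge) (v : vertex GG) : bool :=
  if p is a :: p' then (oorig a == u) && edge_path (oterm a) p' v else u == v.

Definition path_in (T : {set edge GG}) (p : seq oedge) : bool :=
  all (fun a : oedge => a.1 \in T) p.

Definition no_backtrack (p : seq oedge) : bool :=
  sorted (fun a b : oedge => b != orev a) p.

(* [T] is the edge set of a maximal subtree; its existence makes the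
   underlying graph nonempty and connected. *)
Definition spanning_tree (T : {set edge GG}) : Prop :=
  [/\ (0 < #|vertex GG|)%N,
      forall u v, exists2 p, edge_path u p v & path_in T p
    & forall v p, edge_path v p v -> path_in T p -> no_backtrack p ->
        p = [::]].

Definition onto (A B : Type) (f : A -> B) : Prop := forall y, exists x, f x = y.

Definition reduced_graph : Prop :=
  forall e : edge GG, src e <> tgt e -> ~ onto (esrc e) /\ ~ onto (etgt e).

Definition HNN_extension : Prop := #|vertex GG| = 1%N /\ #|edge GG| = 1%N.

Definition not_ascending_HNN : Prop :=
  ~ HNN_extension \/
  HNN_extension /\
    forall e : edge GG, ~ onto (esrc e) /\ ~ onto (etgt e).

(* The letters of the presentation of the fundamental group: the elements of
   the vertex groups, and a stable letter [t_e] (with its inverse) for each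
   edge [e]. *)
Definition letter : Type := ({v : vertex GG & vgroup v} + edge GG * bool)%type.
HB.instance Definition _ := Choice.on letter.
Definition vletter (v : vertex GG) (g : vgroup v) : letter :=
  inl (Tagged (fun v => vgroup v : Type) g).
Definition eletter (e : edge GG) (b : bool) : letter := inr (e, b).
Definition word : Type := seq letter.
HB.instance Definition _ := Choice.on word.

Variable T : {set edge GG}.

(* The congruence of the presentation with respect to [T]:
   [t_e^-1 a t_e = a'] for [a] and [a'] the two images of an element of the
   group of [e], and [t_e = 1] for [e] in [T]. *)
Inductive weq : word -> word -> Prop :=
| weq_refl u : weq u u
| weq_sym u v : weq u v -> weq v u
| weq_trans u v w : weq u v -> weq v w -> weq u w
| weq_cat u u' v v' : weq u u' -> weq v v' -> weq (u ++ v) (u' ++ v')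
| weq_one v : weq [:: vletter (1%g : vgroup v)] [::]
| weq_mul v (g h : vgroup v) :
    weq [:: vletter g; vletter h] [:: vletter (g * h)%g]
| weq_inv e b : weq [:: eletter e b; eletter e (~~ b)] [::]
| weq_edge e (a : egroup e) :
    weq [:: eletter e true; vletter (esrc e a); eletter e false]
        [:: vletter (etgt e a)]
| weq_tree e : e \in T -> weq [:: eletter e false] [::].

Definition weqb (u v : word) : bool := `[< weq u v >].

Lemma weqb_equiv : equiv_class_of weqb.
Proof.
split.
- by move=> u; apply/asboolP; apply: weq_refl.
- by move=> u v; apply/asboolP/asboolP; apply: weq_sym.
- move=> v u w /asboolP uv /asboolP vw; apply/asboolP.
  exact: weq_trans uv vw.
Qed.

Canonical weq_equiv := EquivRelPack weqb_equiv.

Definition pi1 : Type := {eq_quot weq_equiv}%qT.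
HB.instance Definition _ := Choice.on pi1.
HB.instance Definition _ := EqQuotient.on pi1.

Definition wclass (u : word) : pi1 := \pi_pi1%qT u.

Lemma wclassP u v : wclass u = wclass v <-> weq u v.
Proof.
by split=> [/eqquotP/asboolP | uv] //; apply/eqquotP/asboolP.
Qed.

Lemma wclass_repr (x : pi1) : wclass (repr x) = x.
Proof. exact: reprK. Qed.

Lemma weq_repr u : weq (repr (wclass u)) u.
Proof. by apply/wclassP; rewrite wclass_repr. Qed.

Definition linv (l : letter) : letter :=
  match l with
  | inl g => vletter (tagged g)^-1%g
  | inr a => eletter a.1 (~~ a.2)
  end.
Definition winv (u : word) : word := rev (map linv u).

Lemma linvK : involutive linv.
Proof.
case=> [[v g]|[e b]] /=; first by rewrite /vletter /= invgK.
by rewrite /eletter negbK.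
Qed.

Lemma winvK : involutive winv.
Proof. by move=> u; rewrite /winv map_rev revK mapK //; apply: linvK. Qed.

Lemma winv_cat u v : winv (u ++ v) = winv v ++ winv u.
Proof. by rewrite /winv map_cat rev_cat. Qed.

Lemma linv_weq l : weq [:: linv l; l] [::].
Proof.
case: l => [[v g]|[e b]] /=.
  apply: weq_trans (weq_mul _ _) _; rewrite mulVg; exact: weq_one.
by have := weq_inv e (~~ b); rewrite negbK.
Qed.

Lemma winv_weq u : weq (winv u ++ u) [::].
Proof.
elim: u => [|l u IH]; first exact: weq_refl.
rewrite -cat1s winv_cat -catA [X in weq (_ ++ X)]catA.
apply: weq_trans IH; apply: weq_cat; first exact: weq_refl.
rewrite -[X in weq _ X]cat0s; apply: weq_cat (weq_refl _).
exact: linv_weq.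
Qed.

Lemma weq_winv u v : weq u v -> weq (winv u) (winv v).
Proof.
move=> uv.
have h : weq (winv u ++ (v ++ winv v)) (winv u).
  rewrite -[X in weq _ X]cats0; apply: weq_cat (weq_refl _) _.
  by rewrite -{1}(winvK v); apply: winv_weq.
apply: weq_trans (weq_sym h) _; rewrite catA -[X in weq _ X]cat0s.
apply: weq_cat (weq_refl _); apply: weq_trans (winv_weq u).
by apply: weq_cat (weq_refl _) (weq_sym uv).
Qed.

Definition pi1_mul (x y : pi1) : pi1 := wclass (repr x ++ repr y).
Definition pi1_one : pi1 := wclass [::].
Definition pi1_inv (x : pi1) : pi1 := wclass (winv (repr x)).

Lemma pi1_mulE u v : pi1_mul (wclass u) (wclass v) = wclass (u ++ v).
Proof. by apply/wclassP; apply: weq_cat; apply: weq_repr. Qed.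

Lemma pi1_invE u : pi1_inv (wclass u) = wclass (winv u).
Proof. by apply/wclassP; apply: weq_winv; apply: weq_repr. Qed.

Lemma pi1_mulA : associative pi1_mul.
Proof.
move=> x y z; rewrite -(wclass_repr x) -(wclass_repr y) -(wclass_repr z).
by rewrite !pi1_mulE catA.
Qed.

Lemma pi1_mul1 : left_id pi1_one pi1_mul.
Proof. by move=> x; rewrite -(wclass_repr x) pi1_mulE. Qed.

Lemma pi1_1mul : right_id pi1_one pi1_mul.
Proof. by move=> x; rewrite -(wclass_repr x) pi1_mulE cats0. Qed.

Lemma pi1_mulV : left_inverse pi1_one pi1_inv pi1_mul.
Proof.
move=> x; rewrite -(wclass_repr x) pi1_invE pi1_mulE.
by apply/wclassP; apply: winv_weq.
Qed.

Lemma pi1_Vmul : right_inverse pi1_one pi1_inv pi1_mul.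
Proof.
move=> x; rewrite -(wclass_repr x) pi1_invE pi1_mulE; apply/wclassP.
by rewrite -{1}(winvK (repr x)); apply: winv_weq.
Qed.

HB.instance Definition _ :=
  isGroup.Build pi1 pi1_mulA pi1_mul1 pi1_1mul pi1_mulV pi1_Vmul.

Definition vincl (v : vertex GG) (g : vgroup v) : pi1 :=
  wclass [:: vletter g].

Definition eincl (e : edge GG) (a : egroup e) : pi1 := vincl (esrc e a).

End GraphOfGroups.

Section BNS.
Variables (R : realType) (G : groupType).

Definition generates (S : seq G) : Prop :=
  forall g : G, exists2 w : seq G,
    all (fun x => (x \in S) || (x^-1%g \in S)) w & g = (\prod_(x <- w) x)%g.

Definition finitely_generated : Prop := exists S : seq G, generates S.

Definition realHom : set (G -> R) :=
  [set phi | {morph phi : x y / (x * y)%g >-> x + y}].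

Definition nonzero (phi : G -> R) : Prop := exists x, phi x != 0.

(* The class [phi], as a set of functions; points of the character sphere are
   such classes. *)
Definition ray (phi : G -> R) : set (G -> R) :=
  [set psi | exists2 l : R, 0 < l & psi = (fun x => l * phi x)].

Definition char_sphere : set (set (G -> R)) :=
  [set ray phi | phi in [set phi | realHom phi /\ nonzero phi]].

Definition cay_adj (S : seq G) (x y : G) : bool :=
  has (fun s => (y == x * s)%g || (x == y * s)%g) S.

Definition cay_half_connected (S : seq G) (phi : G -> R) : Prop :=
  forall g h : G, 0 <= phi g -> 0 <= phi h ->
    exists p : seq G,
      [/\ path (cay_adj S) g p, last g p = h & all (fun x => 0 <= phi x) p].

Definition Sigma : set (set (G -> R)) :=
  [set ray phi | phi in [set phi |
    [/\ realHom phi, nonzero phi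
      & exists2 S, generates S & cay_half_connected S phi]]].

Definition class_varsigma : Prop := finitely_generated /\ Sigma = char_sphere.

Definition antipode (X : set (set (G -> R))) : set (set (G -> R)) :=
  [set ray (fun x => - phi x) | phi in [set phi | X (ray phi)]].

Definition linear_subspace (W : set (G -> R)) : Prop :=
  [/\ W `<=` realHom, W (fun=> 0)
    & forall (a : R) phi psi, W phi -> W psi ->
        W (fun x => a * phi x + psi x)].

(* [W] is spanned over [R] by its elements coming from [Hom(G, Q)]. *)
Definition defined_over_rat (W : set (G -> R)) : Prop :=
  forall phi, W phi -> exists (n : nat) (c : 'I_n -> R) (q : 'I_n -> G -> rat),
    [/\ forall i, {morph q i : x y / (x * y)%g >-> x + y},
        forall i, W (fun x => ratr (q i x))
      & phi = (fun x => \sum_(i < n) c i * ratr (q i x))].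

Definition subsphere (W : set (G -> R)) : set (set (G -> R)) :=
  [set ray phi | phi in [set phi | W phi /\ nonzero phi]].

Definition rational_subsphere (X : set (set (G -> R))) : Prop :=
  exists W, [/\ linear_subspace W, defined_over_rat W & X = subsphere W].

End BNS.
Arguments realHom : clear implicits.
Arguments char_sphere : clear implicits.
Arguments Sigma : clear implicits.
Arguments class_varsigma : clear implicits.

(* Main.v *)
Require Import Defs.
From HB Require Import structures.
From mathcomp Require Import all_boot all_order all_algebra.
From mathcomp Require Import boolp classical_sets reals.
From mathcomp Require Import lra.

Set Implicit Arguments.
Unset Strict Implicit.
Unset Printing Implicit Defensive.

Import Order.TTheory GRing.Theory Num.Theory.
Local Open Scope classical_set_scope.
Local Open Scope ring_scope.

(* [G] acts on the Bass-Serre tree of the graph of groups.  Moving along a word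
   changes the first edge of the geodesic from a fixed vertex [v] towards the
   moving point only when the point passes through [v].
   If the character vanishes on an edge group, then no path of large height in
   the Cayley graph crosses that edge of the tree, so all elements of large
   height lie on one side of it; translating the edge by a suitable element
   (which exists because the graph is reduced and not an ascending HNN
   extension) gives two disjoint sides that both contain them.
   If the character is in Sigma of [G] and the edge groups are in the class
   varsigma, a path between elements of a vertex group is projected to that
   vertex group: each excursion becomes a path in a coset of an edge group,
   and such a path exists at bounded depth.  With the zero character the same
   projection shows that vertex groups are finitely generated.
   Conversely, if the character is nonzero on edge groups, half-spaces of the
   cosets of vertex groups are connected at bounded depth, and adjacent cosets
   are joined at a high element of the coset of the edge group they share.
   The tree is accessed through normal forms in a multiple HNN extension of the
   product of all vertex groups, to which [G] maps. *)

(** * The fundamental group of a graph of groups *)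

Section Morphisms.
Variables (G H : groupType) (f : G -> H).
Local Open Scope group_scope.
Hypothesis fM : {morph f : x y / x * y}.

Lemma morph_mul1 : f 1 = 1.
Proof. by apply: (mulgI (f 1)); rewrite -fM !mulg1. Qed.

Lemma morph_mulV x : f x^-1 = (f x)^-1.
Proof. by apply: (mulgI (f x)); rewrite -fM !mulgV morph_mul1. Qed.
End Morphisms.

Section Presentation.
Variables (GG : graph_of_groups) (T : {set edge GG}).
Local Open Scope group_scope.

Lemma wclass_cat u v : wclass T (u ++ v) = wclass T u * wclass T v.
Proof. by rewrite -pi1_mulE. Qed.

Definition lclass (l : letter GG) : pi1 T := wclass T [:: l].

Lemma wclass_cons l u : wclass T (l :: u) = lclass l * wclass T u.
Proof. by rewrite -cat1s wclass_cat. Qed.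

Lemma wclass_rcons u l : wclass T (rcons u l) = wclass T u * lclass l.
Proof. by rewrite -cats1 wclass_cat. Qed.

Lemma wclass_nil : wclass T [::] = 1.
Proof. by []. Qed.

Definition stable (a : oedge GG) : pi1 T := wclass T [:: eletter a.1 a.2].

Lemma stable_rev a : stable (orev a) = (stable a)^-1.
Proof.
apply: (mulgI (stable a)); rewrite mulgV -wclass_cat; apply/wclassP.
by case: a => e b; apply: weq_inv.
Qed.

Lemma stable_tree a : a.1 \in T -> stable a = 1.
Proof.
case: a => e b /= eT.
have t1 : stable (e, false) = 1 by apply/wclassP; apply: weq_tree.
by case: b => //; rewrite -[(e, true)]/(orev (e, false)) stable_rev t1 invg1.
Qed.

Lemma vinclM v (g h : vgroup v) : vincl T (g * h) = vincl T g * vincl T h.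
Proof. by rewrite -wclass_cat; apply/wclassP; apply/weq_sym/weq_mul. Qed.

Lemma vincl1 v : vincl T (1 : vgroup v) = 1.
Proof. exact: morph_mul1 (@vinclM v). Qed.

Lemma vinclV v (g : vgroup v) : vincl T g^-1 = (vincl T g)^-1.
Proof. exact: morph_mulV (@vinclM v) g. Qed.

Definition oincl (a : oedge GG) : egroup a.1 -> vgroup (oorig a) :=
  match a with (e, b) =>
    if b return egroup e -> vgroup (oorig (e, b)) then etgt e else esrc e
  end.
Definition oincl' (a : oedge GG) : egroup a.1 -> vgroup (oterm a) :=
  match a with (e, b) =>
    if b return egroup e -> vgroup (oterm (e, b)) then esrc e else etgt e
  end.

Lemma oinclM a : {morph @oincl a : x y / x * y}.
Proof. by case: a => e [] x y /=; rewrite gmulfM. Qed.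

Lemma vincl_oincl a (c : egroup a.1) :
  vincl T (oincl c) * stable a = stable a * vincl T (oincl' c).
Proof.
move: c; case: a => e b /= c.
have h : stable (e, true) * vincl T (esrc e c) * stable (e, false) =
    vincl T (etgt e c).
  rewrite -(wclass_cat [:: _] [:: _]) -(wclass_cat [:: _; _] [:: _]).
  by apply/wclassP; apply: weq_edge.
have tf : stable (e, true) = (stable (e, false))^-1 by rewrite -stable_rev.
by case: b => /=; rewrite -h tf -!mulgA ?mulgV ?mulVg ?mulgA ?mulgV ?mulgK
  ?mulg1 ?mul1g.
Qed.

Lemma pi1_ind (P : pi1 T -> Prop) :
  P 1 -> (forall v (g : vgroup v) x, P x -> P (vincl T g * x)) ->
  (forall a x, P x -> P (stable a * x)) -> forall x, P x.
Proof.
move=> P1 Pv Pe x; rewrite -(wclass_repr x).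
elim: (repr x) => [|l u IH]; first exact: P1.
rewrite wclass_cons; case: l => [[v g]|a]; first exact: Pv.
by case: a => e b; apply: (Pe (e, b)).
Qed.

Section Lift.
Variables (H : groupType) (f : letter GG -> H).
Hypothesis f_mul : forall v (g h : vgroup v),
  f (vletter (g * h)) = f (vletter g) * f (vletter h).
Hypothesis f_inv : forall e b, f (eletter e b) * f (eletter e (~~ b)) = 1.
Hypothesis f_edge : forall e (c : egroup e),
  f (eletter e true) * f (vletter (esrc e c)) * f (eletter e false) =
  f (vletter (etgt e c)).
Hypothesis f_tree : forall e, e \in T -> f (eletter e false) = 1.

Lemma weq_prod u v :
  weq T u v -> \prod_(l <- u) f l = \prod_(l <- v) f l.
Proof.
elim=> {u v} [u||u v w _ + _|u u' v v' _ + _|v|v g h|e b|e c|e eT];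
  rewrite ?big_cons ?big_nil ?mulg1 //.
- by move=> -> ->.
- by rewrite !big_cat => -> ->.
- by apply: (morph_mul1 (@f_mul v)).
- by rewrite mulgA f_edge.
- exact: f_tree.
Qed.

(** Universal property of the presentation: [f] satisfies every defining relation, so its product
    over a word depends only on the class of the word. *)
Lemma pi1_lift : exists F : pi1 T -> H,
  {morph F : x y / x * y} /\ forall l, F (lclass l) = f l.
Proof.
pose F (x : pi1 T) := \prod_(l <- repr x) f l.
have FE u : F (wclass T u) = \prod_(l <- u) f l by apply/weq_prod/weq_repr.
exists F; split=> [x y|l]; last by rewrite FE big_seq1.
by rewrite -{1}(wclass_repr x) -{1}(wclass_repr y) -wclass_cat FE big_cat.
Qed.
End Lift.
End Presentation.

(** * Normal forms in multiple HNN extensions *)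

Section NormalForms.
Variables (K : groupType) (E : finType) (A : E -> groupType).
Variables (i j : forall e, {multiplicative A e -> K}).
Hypotheses (i_inj : forall e, injective (i e)).
Hypotheses (j_inj : forall e, injective (j e)).
Local Open Scope group_scope.

(** With one vertex and the empty tree, the fundamental group is the HNN extension of [K] with one
    stable letter for each element of [E]. *)
Definition multi_hnn : graph_of_groups :=
  @GraphOfGroups unit E (fun=> tt) (fun=> tt) (fun=> K) A i j i_inj j_inj.
Local Notation GK := multi_hnn.
Let W := pi1 (GG := GK) finset.set0.

Definition assoc_in (a : E * bool) (c : A a.1) :
  K := if a.2 then j a.1 c else i a.1 c.
Let al := assoc_in.

Lemma assoc_inM a : {morph @al a : x y / x * y}.
Proof. by case: a => e [] x y; rewrite /al /assoc_in /= gmulfM. Qed.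

Lemma assoc_in_inj a : injective (@al a).
Proof. by case: a => e [] x y; [apply: j_inj | apply: i_inj]. Qed.

Let al1 a : @al a 1 = 1 := morph_mul1 (@assoc_inM a).
Let alV a x : @al a x^-1 = (al x)^-1 := morph_mulV (@assoc_inM a) x.

Definition in_assoc a (g : K) := exists c : A a.1, g = al c.

Lemma in_assocM a g c : in_assoc a (g * @al a c) <-> in_assoc a g.
Proof.
split=> [[d gd]|[d ->]]; last by exists (d * c); rewrite assoc_inM.
by exists (d * c^-1); rewrite assoc_inM alV -gd mulgK.
Qed.

(* The representative of the left coset of [g] modulo the associated subgroup;
   the subgroup itself is represented by [1]. *)
Definition rep a (g : K) : K :=
  if `[< in_assoc a g >] then 1 else xget 1 [set r | in_assoc a (r^-1 * g)].

Lemma rep_coset a g : in_assoc a ((rep a g)^-1 * g).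
Proof.
rewrite /rep; case: asboolP => [|nin]; first by rewrite invg1 mul1g.
have ex : exists r, [set r | in_assoc a (r^-1 * g)] r.
  by exists g; exists 1; rewrite mulVg al1.
exact: (xgetPex 1 ex).
Qed.

Lemma rep_in a g : in_assoc a g <-> rep a g = 1.
Proof.
split=> [ag|r1]; first by rewrite /rep asboolT.
by have := rep_coset a g; rewrite r1 invg1 mul1g.
Qed.

Lemma repM a g (c : A a.1) : rep a (g * al c) = rep a g.
Proof.
rewrite /rep; congr (if _ then _ else xget _ _);
  first exact/asbool_equiv_eq/in_assocM.
by apply/eq_set => r; rewrite mulgA; apply/propext/in_assocM.
Qed.

Definition assoc_part a g : A a.1 := sval (cid (rep_coset a g)).
Lemma rep_assoc_part a g : rep a g * al (assoc_part a g) = g.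
Proof. by rewrite /assoc_part; case: cid => c /= <-; rewrite mulVKg. Qed.

Lemma repK a g : rep a (rep a g) = rep a g.
Proof. by rewrite -{2}(rep_assoc_part a g) repM. Qed.

Lemma rep_al a c : rep a (@al a c) = 1.
Proof. by apply/rep_in; exists c. Qed.

Lemma assoc_partM a r c : rep a r = r -> assoc_part a (r * al c) = c.
Proof.
move=> rr; apply: assoc_in_inj; apply: (mulgI r).
by have := rep_assoc_part a (r * al c); rewrite repM rr.
Qed.

(* A normal form [r1 t_a1 r2 t_a2 ... rn t_an g] is the pair of
   [[:: (an, rn); ...; (a1, r1)]] and [g]. *)
Definition state : Type := (seq ((E * bool) * K) * K)%type.
Let rv (a : E * bool) := (a.1, ~~ a.2).

Definition cancels a (r : K) (s : seq ((E * bool) * K)) :=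
  if s is (b, _) :: _ then (b == rv a) && (r == 1) else false.

Fixpoint reduced (s : seq ((E * bool) * K)) :=
  if s is (a, r) :: s' then [&& rep a r == r, ~~ cancels a r s' & reduced s']
  else true.

(** Right multiplication by [t_a]: the tail is its representative times an associated element, and
    the latter moves across [t_a]. The default of [head] is never read, as [cancels] fails on the
    empty stack. *)
Definition step (a : E * bool) (y : state) : state :=
  if cancels a (rep a y.2) y.1 then
    (behead y.1, (head (a, 1) y.1).2 * @al (rv a) (assoc_part a y.2))
  else ((a, rep a y.2) :: y.1, @al (rv a) (assoc_part a y.2)).

Definition mulr_state (y : state) (k : K) : state := (y.1, y.2 * k).

Definition lact (y : state) (l : letter GK) : state :=
  match l with inl x => mulr_state y (tagged x) | inr a => step a y end.

Lemma rvK a : rv (rv a) = a.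
Proof. by case: a => e b; rewrite /rv /= negbK. Qed.

Lemma step_reduced a y : reduced y.1 -> reduced (step a y).1.
Proof.
case: y => s g rs; rewrite /step /=; case: ifP => cs /=; last first.
  by rewrite repK eqxx cs.
by case: s rs {cs} => [|[b q] s] //= /and3P[].
Qed.

Lemma step_stepV a y : reduced y.1 -> step (rv a) (step a y) = y.
Proof.
case: y => s g; rewrite {2}/step /=; case: ifP => cs rs; last first.
  rewrite /step rep_al /=.
  have -> : a == rv (rv a) by rewrite rvK.
  rewrite eqxx /=; congr (_, _).
  have := rep_assoc_part (rv a) (@al (rv a) (assoc_part a g)).
  rewrite rep_al mul1g => /assoc_in_inj ->.
  case: a {cs} => e b; rewrite /rv /= negbK; exact: rep_assoc_part.
case: s rs cs => [|[b q] s] //= /and3P[/eqP qq nc rs] /andP[/eqP bE /eqP r1].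
rewrite bE in qq nc *; rewrite /step /= repM qq (negPf nc) assoc_partM //.
congr (_, _); rewrite -[RHS](rep_assoc_part a g) r1 mul1g.
by case: a {bE qq nc r1} => e b0; rewrite /rv /= negbK.
Qed.

Lemma step_assoc a y c :
  step a (mulr_state y (@al a c)) = mulr_state (step a y) (@al (rv a) c).
Proof.
rewrite /step /= repM.
have -> : assoc_part a (y.2 * al c) = assoc_part a y.2 * c.
  apply: assoc_in_inj; apply: (mulgI (rep a y.2)).
  by rewrite assoc_inM mulgA rep_assoc_part -{1}(repM y.2 c) rep_assoc_part.
have -> : al (assoc_part a y.2 * c : A (rv a).1) =
    @al (rv a) (assoc_part a y.2) * @al (rv a) c by exact: assoc_inM.
by case: ifP => _; rewrite /mulr_state /= ?mulgA.
Qed.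

Definition act (y : state) (w : word GK) := foldl lact y w.

Lemma act_cat y u v : act y (u ++ v) = act (act y u) v.
Proof. exact: foldl_cat. Qed.

Lemma act_reduced y w : reduced y.1 -> reduced (act y w).1.
Proof.
elim: w y => [|l w IH] y //= ry; apply: IH.
by case: l => [x|a] //=; apply: step_reduced.
Qed.

(** Van der Waerden's argument: every defining relation acts trivially on reduced states, so the
    normal form depends only on the class of the word. *)
Lemma act_weq u v : weq finset.set0 u v ->
  forall y : state, reduced y.1 -> act y u = act y v.
Proof.
elim=> {u v} [u|u v _ IH|u v w _ IH1 _ IH2|u u' v v' _ IHu _ IHv|v|v g h
  |e b|e c|e].
- by [].
- by move=> y ry; rewrite IH.
- by move=> y ry; rewrite IH1 ?IH2.
- by move=> y ry; rewrite !act_cat IHu // IHv // act_reduced.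
- by case=> s g _; rewrite /= /mulr_state /= mulg1.
- by move=> y _; rewrite /= /mulr_state /= mulgA.
- by move=> y ry; apply: (step_stepV (e, b)).
- move=> y ry; rewrite /=.
  have -> : (i e c : K) = @al (rv (e, true)) c by [].
  by rewrite (@step_assoc (e, false)) (step_stepV (e, true)).
- by rewrite finset.inE.
Qed.

Definition nf (x : W) : state := act ([::], 1) (repr x).

Lemma nf_wclass w : nf (wclass finset.set0 w) = act ([::], 1) w.
Proof. by apply: act_weq => //; apply: weq_repr. Qed.

Let hv (k : K) : W := vincl finset.set0 (k : vgroup (g := GK) tt).
Let tv (a : E * bool) : W := stable (GG := GK) finset.set0 a.

Let hvM k l : hv (k * l) = hv k * hv l := @vinclM GK finset.set0 tt k l.
Let hv1 : hv 1 = 1 := @vincl1 GK finset.set0 tt.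
Let tvV a : tv (rv a) = (tv a)^-1 := @stable_rev GK finset.set0 a.
Let hv_tv a (c : A a.1) : hv (al c) * tv a = tv a * hv (@al (rv a) c).
Proof.
by case: a c => e [] c; [apply: (@vincl_oincl GK finset.set0 (e, true)) |
  apply: (@vincl_oincl GK finset.set0 (e, false))].
Qed.

Lemma nf_reduced x : reduced (nf x).1.
Proof. exact: act_reduced. Qed.

Lemma nf1 : nf 1 = ([::], 1).
Proof. by rewrite -[1]wclass_nil nf_wclass. Qed.

Lemma nf_mulr x k : nf (x * hv k) = mulr_state (nf x) k.
Proof. by rewrite -{1}(wclass_repr x) -wclass_cat nf_wclass act_cat. Qed.

Lemma nf_stabler x a : nf (x * tv a) = step a (nf x).
Proof.
by case: a => e b; rewrite -{1}(wclass_repr x) -wclass_cat nf_wclass act_cat.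
Qed.

Definition stack_val (s : seq ((E * bool) * K)) : W :=
  foldr (fun ar x => x * hv ar.2 * tv ar.1) 1 s.
Definition state_val (y : state) : W := stack_val y.1 * hv y.2.

Lemma state_val_step a y : state_val (step a y) = state_val y * tv a.
Proof.
case: y => s g; rewrite /step /=.
have E1 : hv (rep a g) * tv a * hv (@al (rv a) (assoc_part a g)) = hv g * tv a.
  by rewrite -mulgA -hv_tv mulgA -hvM rep_assoc_part.
case: ifP => cs; last by rewrite /state_val /= -[RHS]mulgA -E1 !mulgA.
case: s cs => [|[b q] s] //= /andP[/eqP -> /eqP r1].
rewrite /state_val /= -[RHS]mulgA -E1 r1 hvM hv1 mul1g tvV.
by rewrite !mulgA mulgVK.
Qed.

(** Each action step keeps the value. Since [x] can be rebuilt from [nf x], left multiplication is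
    computed by pushing the stack of [nf x] onto another state. *)
Lemma state_val_nf x : state_val (nf x) = x.
Proof.
rewrite -{2}(wclass_repr x) /nf.
elim/last_ind: (repr x) => [|w l IH].
  by rewrite /act /state_val /= hv1 mulg1.
rewrite /act foldl_rcons wclass_rcons -IH; case: l => [[[] k]|a] /=.
  by rewrite /state_val /= hvM mulgA.
by rewrite state_val_step; case: a.
Qed.

(* The bottom of the stack of [nf x] is the edge at the base vertex of the
   Bass-Serre tree that points towards [x]. *)
Definition bottom (s : seq ((E * bool) * K)) : option ((E * bool) * K) :=
  if s is x :: s' then Some (last x s') else None.

Lemma bottom_cons x s : bottom (x :: s) =
  if bottom s is Some y then Some y else Some x.
Proof. by case: s. Qed.

Lemma bottom_cat s s' : bottom (s ++ s') =
  if bottom s' is Some y then Some y else bottom s.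
Proof. by case: s s' => [|x s] [|y s'] //=; rewrite ?cats0 // last_cat. Qed.

Lemma bottom_reduced s a r : reduced s -> bottom s = Some (a, r) -> rep a r = r.
Proof.
elim: s => [|[b q] s IH] //; rewrite bottom_cons => /= /and3P[/eqP e0 _ rs].
case E0: (bottom s) => [p|]; last by case=> <- <-.
by rewrite -E0; apply: IH.
Qed.

Definition push (y : state) (s : seq ((E * bool) * K)) : state :=
  foldr (fun ar z => step ar.1 (mulr_state z ar.2)) y s.

Lemma nf_push x s k : nf (x * stack_val s * hv k) =
  mulr_state (push (nf x) s) k.
Proof.
rewrite nf_mulr; congr mulr_state; elim: s => [|[a r] s IH] /=;
  first by rewrite mulg1.
by rewrite !mulgA nf_stabler nf_mulr IH.
Qed.

(* Appending a reduced stack that does not cancel with the state only pushes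
   letters, so the bottom of the stack survives. *)
Lemma push_reduced y s : reduced s ->
  (if bottom s is Some (a, r) then ~~ cancels a (rep a (y.2 * r)) y.1 else
    true) ->
  exists s' g, [/\ push y s = (s' ++ y.1, g),
    if s is (a, _) :: _ then
      in_assoc (rv a) g /\ (if s' is (a', _) :: _ then a' = a else False)
    else g = y.2 /\ s' = [::]
    & bottom s' = if bottom s is Some (a, r) then Some (a,
      rep a (y.2 * r)) else None].
Proof.
elim: s => [|[a r] s IH]; first by move=> _ _; exists [::], y.2; case: y.
rewrite bottom_cons => /= /and3P[/eqP rr nc rs] cp.
have [|s' [g [-> hs bs]]] := IH rs; first by case: (bottom s) cp.
exists ((a, rep a (g * r)) :: s'), (@al (rv a) (assoc_part a (g * r))); split.
- rewrite /step /= ifN; first by [].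
  case: s s' hs bs nc cp {IH rs} =>
    [|[b q] s] [|[b' q'] s'] //= [h1 h2] bs nc cp.
  + by rewrite h1.
  + by case: h2.
  (* The tail [g] left by the previous push lies in the associated subgroup of [a]; a pinch would
     put [r] there too, so [r] would be [1] and the stack being pushed would not be reduced. *)
  + rewrite h2; apply: contra nc => /andP[/eqP ba /eqP g1]; rewrite ba eqxx /=.
    have [c gc] : in_assoc a g by move: h1; rewrite ba rvK.
    have /rep_in [d gd] := g1.
    have /rep_in : in_assoc a r.
      by exists (c^-1 * d); rewrite assoc_inM -/(al _) alV -gc -gd mulKg.
    by rewrite rr => ->.
- by split=> //; exists (assoc_part a (g * r)).
- rewrite bottom_cons bs; case: s hs {IH rs nc cp bs} =>
    [[-> _]|] //= [b q] s _.
  by case: (last _ _).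
Qed.

(** The stack of [hv k] is empty, so pushing the normal form of [x] onto it cancels nothing and only
    multiplies the first coset by [k]. *)
Lemma bottom_hv k x : bottom (nf (hv k * x)).1 =
  if bottom (nf x).1 is Some (a, r) then Some (a, rep a (k * r)) else None.
Proof.
rewrite -{1}(state_val_nf x) /state_val mulgA nf_push.
have nfk : nf (hv k) = ([::], k) 
    by rewrite -[hv k]mul1g nf_mulr nf1 /mulr_state mul1g.
have [] := @push_reduced (nf (hv k)) _ (nf_reduced x).
  by rewrite nfk /=; case: (bottom _) => [[]|].
by rewrite nfk => s' [g [-> _ <-]]; rewrite /= cats0.
Qed.

(** The excluded case is the one where [x] starts by retracing [a]; otherwise [push_reduced] leaves
    [a] at the bottom. *)
Lemma bottom_stable a x : bottom (nf x).1 <> Some (rv a, 1) ->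
  bottom (nf (tv a * x)).1 = Some (a, 1).
Proof.
move=> bx; rewrite -{1}(state_val_nf x) /state_val mulgA nf_push.
have r1 : rep a 1 = 1 by rewrite -(al1 a) rep_al.
have nfa : nf (tv a) = ([:: (a, 1)], 1).
  rewrite -[tv a]mul1g nf_stabler nf1 /step /= r1; congr (_, _).
  have := rep_assoc_part a 1;
    rewrite r1 mul1g -[RHS](al1 a) => /assoc_in_inj ->.
  exact: al1.
have [] := @push_reduced (nf (tv a)) _ (nf_reduced x).
  rewrite nfa /=; case bE: (bottom _) => [[b q]|] //; rewrite mul1g.
  apply/negP => /andP[/eqP ab /eqP q1]; apply: bx; rewrite bE.
  by rewrite -(bottom_reduced (nf_reduced x) bE) q1 ab rvK.
by rewrite nfa => s' [g [-> _ _]]; rewrite /= bottom_cat.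
Qed.

End NormalForms.

(** * Paths and vertices of the Bass-Serre tree *)

Section VertexProduct.
Variable GG : graph_of_groups.
Local Open Scope group_scope.

Definition vprod : Type := forall v : vertex GG, vgroup v.
HB.instance Definition _ := Choice.on vprod.

Definition vprod_mul (x y : vprod) : vprod := fun v => x v * y v.
Definition vprod_one : vprod := fun v => 1.
Definition vprod_inv (x : vprod) : vprod := fun v => (x v)^-1.

Lemma vprod_mulA : associative vprod_mul.
Proof. by move=> x y z; apply: functional_extensionality_dep => v;
  apply: mulgA. Qed.
Lemma vprod_mul1 : left_id vprod_one vprod_mul.
Proof. by move=> x; apply: functional_extensionality_dep => v;
  apply: mul1g. Qed.
Lemma vprod_1mul : right_id vprod_one vprod_mul.
Proof. by move=> x; apply: functional_extensionality_dep => v;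
  apply: mulg1. Qed.
Lemma vprod_mulV : left_inverse vprod_one vprod_inv vprod_mul.
Proof. by move=> x; apply: functional_extensionality_dep => v;
  apply: mulVg. Qed.
Lemma vprod_Vmul : right_inverse vprod_one vprod_inv vprod_mul.
Proof. by move=> x; apply: functional_extensionality_dep => v;
  apply: mulgV. Qed.

HB.instance Definition _ :=
  isGroup.Build vprod vprod_mulA vprod_mul1 vprod_1mul vprod_mulV vprod_Vmul.

Definition emb (v : vertex GG) (g : vgroup v) : vprod :=
  dfwith (fun v => 1 : vgroup v) g.

Lemma embM v : {morph @emb v : g h / g * h}.
Proof.
move=> g h; apply: functional_extensionality_dep => u.
rewrite -[RHS]/(emb g u * emb h u) /emb.
have [<-|vu] := eqVneq v u; first by rewrite !dfwith_in.
by rewrite !dfwith_out // mulg1.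
Qed.

Lemma emb_inj v : injective (@emb v).
Proof. by move=> g h /(congr1 (fun x : vprod => x v));
  rewrite /emb !dfwith_in. Qed.

HB.instance Definition _ v := isMultiplicative.Build (vgroup v) vprod (@emb v)
  (@embM v).

Definition esrcK e : {multiplicative egroup e -> vprod} := @emb _ \o @esrc GG e.
Definition etgtK e : {multiplicative egroup e -> vprod} := @emb _ \o @etgt GG e.

Lemma esrcK_inj e : injective (esrcK e).
Proof. by move=> x y /emb_inj/esrc_inj. Qed.
Lemma etgtK_inj e : injective (etgtK e).
Proof. by move=> x y /emb_inj/etgt_inj. Qed.

End VertexProduct.

Section Paths.
Variable GG : graph_of_groups.
Implicit Types (u v : vertex GG) (p q : seq (oedge GG)).

Lemma orevK : involutive (@orev GG).
Proof. by case=> e b; rewrite /orev negbK. Qed.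
Lemma oorig_rev a : oorig (@orev GG a) = oterm a.
Proof. by case: a => e []. Qed.
Lemma oterm_rev a : oterm (@orev GG a) = oorig a.
Proof. by case: a => e []. Qed.

Lemma edge_path_cat u p q w :
  edge_path u (p ++ q) w <-> exists2 v, edge_path u p v & edge_path v q w.
Proof.
elim: p u => [|a p IH] u /=.
  by split=> [h|[v /eqP ->]//]; exists u; rewrite ?eqxx.
split=> [/andP[-> /IH[v pv qv]]|[v /andP[-> pv] qv]]; first by exists v.
by apply/IH; exists v.
Qed.

Definition path_rev p : seq (oedge GG) := rev (map (@orev GG) p).

Lemma edge_path_rev u p v : edge_path u p v -> edge_path v (path_rev p) u.
Proof.
elim: p u => [|a p IH] u /=; first by rewrite eq_sym.
case/andP=> /eqP <- /IH h; rewrite /path_rev /= rev_cons -cats1.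
by apply/edge_path_cat; exists (oterm a); rewrite //= oorig_rev oterm_rev !eqxx.
Qed.

Lemma path_in_rev T p : path_in T (path_rev p) = path_in T p.
Proof. by rewrite /path_in /path_rev all_rev all_map. Qed.

Lemma path_in_cat T p q : path_in T (p ++ q) = path_in T p && path_in T q.
Proof. exact: all_cat. Qed.

Lemma backtrackE p : ~~ no_backtrack p ->
  exists p1 a p2, p = p1 ++ a :: orev a :: p2.
Proof.
case: p => [|a p] //; rewrite /no_backtrack /=.
elim: p a => [|b p IH] a //=; rewrite negb_and negbK => /orP[/eqP ->|].
  by exists [::], a, p.
by case/IH=> p1 [c [p2 E]]; exists (a :: p1), c, p2; rewrite E.
Qed.
End Paths.

Section Walk.
Variables (GG : graph_of_groups) (T : {set edge GG}).
Hypothesis treeT : spanning_tree T.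
Local Open Scope group_scope.
Local Notation G := (pi1 T).

(* A pair of [x : G] and a vertex [u] stands for the vertex [x G_u] of the
   Bass-Serre tree. *)
Section Relation.
Variables (good : G -> Prop) (ok : letter GG -> Prop).
Variable Q : G -> vertex GG -> G -> vertex GG -> Prop.
Hypothesis Q_refl : forall x u, good x -> Q x u x u.
Hypothesis Q_trans : forall x u y v z w,
  good y -> Q x u y v -> Q y v z w -> Q x u z w.
Hypothesis Q_vertex : forall x u (h : vgroup u), ok (vletter h) ->
  good x -> good (x * vincl T h) -> Q x u (x * vincl T h) u.
Hypothesis Q_edge : forall x a, good x -> good (x * stable T a) ->
  Q x (oorig a) (x * stable T a) (oterm a).

Lemma walk_tree x u v : good x -> Q x u x v.
Proof.
move=> gx; have [_ /(_ u v)[p puv pT] _] := treeT.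
elim: p u puv pT => [|a p IH] u /=; first by move=> /eqP <- _; apply: Q_refl.
case/andP=> /eqP <- pv /andP[aT pT]; apply: Q_trans (IH _ pv pT) => //.
have := @Q_edge x a; rewrite stable_tree // mulg1; exact.
Qed.

(** The word is read letter by letter. Between letters the vertex is changed along [T] at a fixed
    group element, since stable letters of [T] are trivial. *)
Lemma walk_word w x u v : (forall l, l \in w -> ok l) ->
  (forall w1 w2, w = w1 ++ w2 -> good (x * wclass T w1)) ->
  Q x u (x * wclass T w) v.
Proof.
elim: w x u => [|l w IH] x u okw gw.
  by have := gw [::] [::] erefl; rewrite wclass_nil mulg1; apply: walk_tree.
have gx : good x by have := gw [::] _ erefl; rewrite wclass_nil mulg1.
have gl : good (x * lclass T l) by apply: (gw [:: l] w).
have okl : ok l by apply: okw; rewrite mem_head.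
have step : forall u', Q (x * lclass T l) u' (x * wclass T (l :: w)) v.
  move=> u'; rewrite wclass_cons mulgA; apply: IH => [l' lw|w1 w2 E].
    by apply: okw; rewrite inE lw orbT.
  by rewrite -mulgA -wclass_cons; apply: (gw _ w2); rewrite E.
case: l okl gl step {gw okw} => [[z g]|[e b]] okl gl step.
  apply: (Q_trans gx (walk_tree u z gx)).
  exact: Q_trans gl (Q_vertex okl gx gl) (step z).
apply: (Q_trans gx (walk_tree u (oorig (e, b)) gx)).
exact: Q_trans gl (Q_edge (a := (e, b)) gx gl) (step _).
Qed.
End Relation.

Lemma walk_ind (P : vertex GG -> G -> Prop) v :
  P v 1 -> (forall u x (h : vgroup u), P u x -> P u (x * vincl T h)) ->
  (forall a x, P (oorig a) x -> P (oterm a) (x * stable T a)) ->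
  forall u x, P u x.
Proof.
move=> P1 Pv Pe u x.
suff : P v 1 -> P u (1 * x) by rewrite mul1g; apply.
rewrite -(wclass_repr x).
apply: (@walk_word (fun=> True) (fun=> True) (fun x u y v => P u x ->
  P v y)) => //.
- by move=> *; auto.
- by move=> y z h _ _ _; apply: Pv.
- by move=> y a _ _; apply: Pe.
Qed.
End Walk.

(** * Geodesics of the Bass-Serre tree through normal forms *)

Section BassSerre.
Variables (GG : graph_of_groups) (T : {set edge GG}).
Hypothesis treeT : spanning_tree T.
Local Open Scope group_scope.
Local Notation G := (pi1 T).
Local Notation V := (vertex GG).
Local Notation K := (vprod GG).
Implicit Types (x y : G) (u v w : V) (a b : oedge GG).

(* [W] is a multiple HNN extension of the product of all vertex groups; the
   Bass-Serre tree of [G] embeds in that of [W], whose normal forms are free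
   of dependent types. *)
Let GK := multi_hnn (@esrcK_inj GG) (@etgtK_inj GG).
Let W := pi1 (GG := GK) finset.set0.
Let hv (k : K) : W := vincl finset.set0 (k : vgroup (g := GK) tt).
Let tv (a : oedge GG) : W := stable (GG := GK) finset.set0 a.
Let hvM k l : hv (k * l) = hv k * hv l := @vinclM GK finset.set0 tt k l.
Let tvV a : tv (orev a) = (tv a)^-1 := @stable_rev GK finset.set0 a.

Let tpath (p : seq (oedge GG)) : W := \prod_(a <- p) tv a.

(** Removing a backtrack keeps the product and shortens the path; a closed path in the tree without
    backtracks is empty. *)
Lemma tree_path_loop v p : edge_path v p v -> path_in T p -> tpath p = 1.
Proof.
have [_ _ tree] := treeT.
elim/ltn_ind: {p}(size p) {-2}p (erefl (size p)) => n IH p pn pv pT.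
have [/(tree v p pv pT) ->|/backtrackE[p1 [a [p2 E]]]] := boolP (no_backtrack
  p).
  by rewrite /tpath big_nil.
have -> : tpath p = tpath (p1 ++ p2).
  by rewrite E /tpath !big_cat /= !big_cons tvV mulVKg.
move: pv pT; rewrite E => /edge_path_cat[u pu] /= /andP[/eqP au].
rewrite oorig_rev eqxx oterm_rev au => /= pu2.
rewrite path_in_cat /= => /andP[p1T /and3P[_ _ p2T]].
apply: (IH (size (p1 ++ p2))) => //.
- by rewrite -pn E !size_cat /= !addnS ltnS leqnSn.
- by apply/edge_path_cat; exists u.
- by rewrite path_in_cat p1T.
Qed.

Lemma tree_path_rev p : tpath (path_rev p) = (tpath p)^-1.
Proof.
elim: p => [|a p IH]; first by rewrite /tpath !big_nil invg1.
rewrite /path_rev /= rev_cons -cats1 /tpath big_cat big_seq1 big_cons invgM tvV.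
by rewrite -/(path_rev p) -/(tpath _) IH.
Qed.

Lemma root_path : exists (v0 : V) (p : V -> seq (oedge GG)),
  forall u, edge_path v0 (p u) u /\ path_in T (p u).
Proof.
have [/card_gt0P[v0 _] conn _] := treeT; exists v0.
have /choice[p pP] : forall u, exists p, edge_path v0 p u /\ path_in T p.
  by move=> u; have [p] := conn v0 u; exists p.
by exists p.
Qed.

Let v0 := sval (cid root_path).
Let tp := sval (cid (svalP (cid root_path))).
Let pt u : W := tpath (tp u).

Let tpP u : edge_path v0 (tp u) u /\ path_in T (tp u).
Proof. exact: (svalP (cid (svalP (cid root_path)))). Qed.

Lemma tree_path_edge a : a.1 \in T ->
  pt (oorig a) * tv a * (pt (oterm a))^-1 = 1.
Proof.
move=> aT; rewrite -tree_path_rev.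
have -> : tv a = tpath [:: a] by rewrite /tpath big_seq1.
have [p1 t1] := tpP (oorig a); have [p2 t2] := tpP (oterm a).
rewrite -[LHS]/(tpath _ * tpath [:: a] * tpath _) /tpath -!big_cat.
apply: (@tree_path_loop v0);
  last by rewrite !path_in_cat path_in_rev t1 t2 /= aT.
apply/edge_path_cat; exists (oterm a); last exact: edge_path_rev.
by apply/edge_path_cat; exists (oorig a); rewrite //= !eqxx.
Qed.

(** Conjugation by tree paths turns vertex groups and edges into loops at the root; the edges of [T]
    then become trivial by [tree_path_edge], as the presentation requires. *)
Lemma to_hnn : exists F : G -> W, {morph F : x y / x * y} /\
  (forall v (g : vgroup v), F (vincl T g) = pt v * hv (emb g) * (pt v)^-1) /\
  forall a, F (stable T a) = pt (oorig a) * tv a * (pt (oterm a))^-1.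
Proof.
pose f (l : letter GG) : W := match l with
  | inl g => pt (tag g) * hv (emb (tagged g)) * (pt (tag g))^-1
  | inr a => pt (oorig a) * tv a * (pt (oterm a))^-1
  end.
have [|||e eT|F [FM FE]] := @pi1_lift GG T W f.
- by move=> v g h; rewrite /= embM hvM !mulgA mulgVK.
- move=> e b; rewrite /= -[(e, ~~ b)]/(orev (e, b)).
  by rewrite oorig_rev oterm_rev tvV !mulgA mulgVK mulgK mulgV.
- move=> e c; rewrite /= !mulgA !mulgVK; congr (_ * _); rewrite -!mulgA;
    congr (_ * _).
  have := @vincl_oincl GK finset.set0 (e, false) c.
  rewrite -/(tv (e, false)) -[X in X * _]/(hv (emb (esrc e c))) => ->.
  by rewrite -[(e, true)]/(orev (e, false)) tvV mulKg.
- exact: (tree_path_edge (a := (e, false))).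
exists F; split=> //; split=> [v g|[e b]];
  [exact: FE | exact: (FE (eletter e b))].
Qed.

Let psi := sval (cid to_hnn).
Let psiM : {morph psi : x y / x * y} := (svalP (cid to_hnn)).1.
Let psi_v v (g : vgroup v) : psi (vincl T g) = pt v * hv (emb g) * (pt v)^-1 :=
  (svalP (cid to_hnn)).2.1 v g.
Let psi_t a : psi (stable T a) = pt (oorig a) * tv a * (pt (oterm a))^-1 :=
  (svalP (cid to_hnn)).2.2 a.

(* The geodesic of the Bass-Serre tree from the vertex fixed by the vertex
   group of [v] to the one fixed by the conjugate by [x] of that of [u]. *)
Definition geod v u x : state K (edge GG) := nf ((pt v)^-1 * psi x * pt u).

Definition coset_rep a (k : K) : K := rep (@esrcK GG) (@etgtK GG) a k.

Lemma assoc_inE a c : assoc_in (@esrcK GG) (@etgtK GG) (a := a) c =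
  emb (oincl c).
Proof. by case: a c => e []. Qed.
Lemma assoc_in_revE a (c : egroup a.1) :
  assoc_in (@esrcK GG) (@etgtK GG) (a := (a.1, ~~ a.2)) c = emb (oincl' c).
Proof. by case: a c => e []. Qed.

Lemma coset_rep_eq a (g h : vgroup (oorig a)) :
  coset_rep a (emb g) = coset_rep a (emb h) ->
    exists c, h = g * oincl (a := a) c.
Proof.
have := rep_assoc_part (@esrcK GG) (@etgtK GG) a (emb g).
have := rep_assoc_part (@esrcK GG) (@etgtK GG) a (emb h).
rewrite -!/(coset_rep _ _) !assoc_inE; move: (assoc_part _ _ _ _) => c' hE.
move: (assoc_part _ _ _ _) => c gE rE; exists (c^-1 * c'); apply: emb_inj.
rewrite embM oinclM embM -gE -hE -rE (morph_mulV (@oinclM GG a)).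
by rewrite (morph_mulV (@embM GG _)) mulgA mulgK.
Qed.

Lemma coset_rep_mulr a (g : vgroup (oorig a)) (c : egroup a.1) :
  coset_rep a (emb (g * oincl c)) = coset_rep a (emb g).
Proof. by rewrite embM -assoc_inE; apply: repM. Qed.

Lemma coset_rep1 a : coset_rep a 1 = 1.
Proof.
by rewrite -[X in coset_rep a X](morph_mul1 (assoc_inM (@esrcK GG) (@etgtK GG)
  (a := a))); apply: rep_al.
Qed.

Lemma coset_rep_emb1 a (g : vgroup (oorig a)) :
  coset_rep a (emb g) = 1 -> exists c, g = oincl (a := a) c.
Proof.
move=> g1; have [|c ->] := @coset_rep_eq a 1 g; last by exists c; rewrite mul1g.
by rewrite g1 (morph_mul1 (@embM GG _)) coset_rep1.
Qed.

Lemma geod1 v : geod v v 1 = ([::], 1).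
Proof. by rewrite /geod (morph_mul1 psiM) mulg1 mulVg; apply: nf1. Qed.

Lemma geod_vertex v u x (h : vgroup u) :
  geod v u (x * vincl T h) = mulr_state (geod v u x) (emb h).
Proof. by rewrite /geod psiM psi_v -nf_mulr !mulgA mulgVK. Qed.

Lemma geod_edge v a x :
  geod v (oterm a) (x * stable T a) =
  step (@esrcK GG) (@etgtK GG) a (geod v (oorig a) x).
Proof. by rewrite /geod psiM psi_t -nf_stabler !mulgA mulgVK. Qed.

(* [typed v s u k x]: the normal form [(s, k)] is a path in the graph of groups
   from [v] to [u], with value [x] in [G]. *)
Fixpoint typed v (s : seq (oedge GG * K)) u (k : K) x : Prop :=
  match s with
  | [::] => exists g : vgroup v, [/\ u = v, k = emb g & x = vincl T g]
  | (a, r) :: s' => exists y (g : vgroup (oterm a)),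
     [/\ u = oterm a, k = emb g, typed v s' (oorig a) r y &
         x = y * stable T a * vincl T g]
  end.

Lemma typed_emb v s u k x : typed v s u k x -> exists g : vgroup u, k = emb g.
Proof.
case: s => [|[a r] s] /=; first by case=> g [-> -> _]; exists g.
by case=> y [g [-> -> _ _]]; exists g.
Qed.

Lemma typed_mulr v s u k x (h : vgroup u) :
  typed v s u k x -> typed v s u (k * emb h) (x * vincl T h).
Proof.
case: s => [|[a r] s] /=.
  case=> g [uv -> ->]; case: v / uv g => g.
  by exists (g * h); rewrite embM vinclM.
case=> y [g [ua -> ty ->]]; move: h; rewrite ua => h.
by exists y, (g * h); rewrite embM vinclM mulgA.
Qed.

(** Crossing [a] moves an edge group element from one end of [a] to the other, and a cancellation
    undoes the last edge, so normal forms coming from [G] remain paths in the graph of groups. *)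
Lemma typed_step v a (y : state K (edge GG)) x :
  typed v y.1 (oorig a) y.2 x ->
  let z := step (@esrcK GG) (@etgtK GG) a y in
  typed v z.1 (oterm a) z.2 (x * stable T a).
Proof.
case: y => s k /= ty; have [g kg] := typed_emb ty.
have := rep_assoc_part (@esrcK GG) (@etgtK GG) a k.
rewrite /step /= assoc_in_revE assoc_inE; set c := assoc_part _ _ _ _ => rc.
have xc : x * (vincl T (oincl c))^-1 * stable T a * vincl T (oincl' c) =
  x * stable T a.
  by rewrite -mulgA -vincl_oincl mulgA mulgVK.
case: ifP => cs; last first.
  exists (x * (vincl T (oincl c))^-1), (oincl' c); split=> //.
  rewrite -vinclV -[rep _ _ _ _](mulgK (emb (oincl c))) rc.
  rewrite -(morph_mulV (@embM GG (oorig a))).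
  exact: typed_mulr.
case: s ty cs => [|[b r] s] //= [y [h [ab kh ty xE]]] /andP[/eqP bE /eqP r1].
move: rc; rewrite r1 mul1g kh; subst b.
move: h {kh} xE ty ab; rewrite {r1 g kg xc} /c;
  move: (assoc_part _ _ _ _) => {}c.
have tV := stable_rev T a; rewrite /orev in tV; rewrite tV {tV}.
case: a c => e [] c h /= -> ty _ /emb_inj <-; rewrite -!mulgA.
  rewrite (_ : vincl T (etgt e c) * stable T (e, true) =
    stable T (e, true) * vincl T (esrc e c)) ?mulKg; first exact: typed_mulr.
  exact: (vincl_oincl T (a := (e, true))).
rewrite (_ : vincl T (esrc e c) * stable T (e, false) =
  stable T (e, false) * vincl T (etgt e c)) ?mulKg; first exact: typed_mulr.
exact: (vincl_oincl T (a := (e, false))).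
Qed.

Lemma typed_geod v u x : typed v (geod v u x).1 u (geod v u x).2 x.
Proof.
move: u x; apply: (walk_ind treeT (v := v)).
- by rewrite geod1 /=; exists 1; rewrite vincl1 (morph_mul1 (@embM GG v)).
- by move=> u x h ty; rewrite geod_vertex; apply: typed_mulr.
- by move=> a x ty; rewrite geod_edge; apply: typed_step.
Qed.

(* The first edge of the geodesic from [v] to the vertex [x G_u], given by an
   oriented edge [a] at [v] and the representative of a coset of its group;
   [None] when the two vertices agree. *)
Definition dir v u x : option (oedge GG * K) := bottom (geod v u x).1.

Lemma dir_none v u x : dir v u x = None ->
  exists g : vgroup v, [/\ u = v, x = vincl T g & geod v u x = ([::], emb g)].
Proof.
rewrite /dir; have := typed_geod v u x.
by case: (geod v u x) => [[|b s] k] //= [g [uv -> xg]] _; exists g.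
Qed.

Lemma dir_vincl v (g : vgroup v) : dir v v (vincl T g) = None.
Proof. by rewrite /dir -[vincl T g]mul1g geod_vertex geod1. Qed.

Lemma dir_some v u x a k : dir v u x = Some (a, k) ->
  oorig a = v /\ exists g : vgroup v, k = coset_rep a (emb g).
Proof.
have red : reduced (esrcK (GG := GG)) (@etgtK GG) (geod v u x).1.
  exact: nf_reduced.
move=> dE; have := bottom_reduced red dE; rewrite -/(coset_rep a k) => <-.
move: dE {red}; rewrite /dir; move: (typed_geod v u x);
  move: (geod v u x) => [s k'] /=.
elim: s u x k' => [|[b r] s IH] u x k' //= [y [g [_ _ ty _]]].
rewrite -/(bottom ((b, r) :: s)) bottom_cons.
case bE : (bottom s) => [ak|]; first by rewrite -bE; apply: IH ty.
case: s bE ty {IH} => //= _ [h [bv rh _]] [<- <-]; split=> //.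
by exists h; rewrite rh.
Qed.

Lemma vincl_inj v : injective (@vincl GG T v).
Proof.
move=> g h /(congr1 (fun x => (geod v v x).2)).
by rewrite -[vincl T g]mul1g -[vincl T h]mul1g !geod_vertex geod1 /= !mul1g =>
  /emb_inj.
Qed.

Lemma dir_vertex v u x (h : vgroup u) : dir v u (x * vincl T h) = dir v u x.
Proof. by rewrite /dir geod_vertex. Qed.

(** [step] pushes or pops at the top of the stack, so the bottom can change only if the stack is
    empty before or after. *)
Lemma dir_edge v a x : dir v (oorig a) x <> None ->
  dir v (oterm a) (x * stable T a) <> None ->
  dir v (oterm a) (x * stable T a) = dir v (oorig a) x.
Proof.
rewrite /dir geod_edge /step; case: (geod v (oorig a) x) => s k /=.
case: s => [|b s] //; case: ifP => _ //=; by case: s.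
Qed.

Lemma dir_leave a v (g : vgroup v) : oorig a = v ->
  dir v (oterm a) (vincl T g * stable T a) = Some (a, coset_rep a (emb g)).
Proof.
move=> av; case: v / av g => g.
by rewrite /dir geod_edge -[vincl T g]mul1g geod_vertex geod1 /step /= mul1g.
Qed.

Lemma dir_mull v u x (h : vgroup v) : dir v u (vincl T h * x) =
  if dir v u x is Some (a, k) then Some (a, coset_rep a (emb h * k)) else None.
Proof.
by rewrite /dir /geod psiM psi_v -(bottom_hv (emb h)) !mulgA mulVg mul1g.
Qed.

Lemma dir_stable u a x : dir (oterm a) u x <> Some (orev a, 1) ->
  dir (oorig a) u (stable T a * x) = Some (a, 1).
Proof.
move=> h; rewrite /dir /geod psiM psi_t !mulgA mulVg mul1g -!mulgA.
by apply: (bottom_stable (a := a)); rewrite !mulgA.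
Qed.
End BassSerre.

(** * Connectivity of half-spaces of Cayley graphs *)

Section Connected.
Variables (R : realType) (G : groupType).
Implicit Types (S : seq G) (phi : G -> R) (L M : R) (g h z : G).

Lemma realHom1 phi : realHom R G phi -> phi 1%g = 0.
Proof. by move=> pM; apply: (addrI (phi 1%g)); rewrite -pM mulg1 addr0. Qed.

Lemma realHomV phi g : realHom R G phi -> phi g^-1%g = - phi g.
Proof.
by move=> pM; apply: (addrI (phi g)); rewrite -pM mulgV (realHom1 pM) subrr.
Qed.

Lemma realHomX phi g n : realHom R G phi -> phi (g ^+ n)%g = phi g *+ n.
Proof.
move=> pM; elim: n => [|n IH]; first by rewrite expg0 (realHom1 pM).
by rewrite expgS pM IH mulrS.
Qed.

(** The bound also covers the start [g], so that such paths can be reversed. *)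
Definition conn S phi L g h := exists p : seq G,
  [/\ path (cay_adj S) g p, last g p = h & all (fun x => L <= phi x) (g :: p)].

Lemma cay_adjC S : symmetric (cay_adj S).
Proof. by move=> x y; apply: eq_has => s; rewrite orbC. Qed.

Lemma conn_refl S phi L g : L <= phi g -> conn S phi L g g.
Proof. by move=> Lg; exists [::]; rewrite /= Lg. Qed.

Lemma conn_trans S phi L h g k :
  conn S phi L g h -> conn S phi L h k -> conn S phi L g k.
Proof.
move=> [p [pp lp ap]] [q [qq lq aq]]; exists (p ++ q); split.
- by rewrite cat_path pp lp.
- by rewrite last_cat lp.
- by move: ap aq => /= /andP[-> ap] /andP[_ aq]; rewrite all_cat ap.
Qed.

Lemma conn_adj S phi L g h : cay_adj S g h -> L <= phi g -> L <= phi h ->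
  conn S phi L g h.
Proof. by move=> gh Lg Lh; exists [:: h]; rewrite /= gh Lg Lh. Qed.

Lemma conn_sym S phi L g h : conn S phi L g h -> conn S phi L h g.
Proof.
move=> [p [pp <- ap]]; elim: p g pp ap => [|x p IH] g /=.
  by move=> _ /andP[Lg _]; apply: conn_refl.
move=> /andP[gx xp] /and3P[Lg Lx ap].
apply: (@conn_trans _ _ _ x); first by apply: IH; rewrite //= Lx.
by apply: conn_adj; rewrite // cay_adjC.
Qed.

Lemma conn_gen S phi L g s : s \in S -> L <= phi g -> L <= phi (g * s)%g ->
  conn S phi L g (g * s)%g.
Proof.
move=> sS Lg Lgs; apply: conn_adj => //; apply/hasP; exists s => //.
by rewrite eqxx.
Qed.

Lemma conn_genV S phi L g s : s \in S -> L <= phi g -> L <= phi (g * s^-1)%g ->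
  conn S phi L g (g * s^-1)%g.
Proof.
move=> sS Lg Lgs; apply: conn_adj => //; apply/hasP; exists s => //.
by rewrite mulgVK eqxx orbT.
Qed.

Lemma conn_le S phi L L' g h : L' <= L -> conn S phi L g h -> conn S phi L' g h.
Proof.
move=> LL [p [pp lp ap]]; exists p; split=> //; apply: sub_all ap => x.
exact: le_trans.
Qed.

Lemma cay_half_connectedP S phi : cay_half_connected S phi <->
  forall g h, 0 <= phi g -> 0 <= phi h -> conn S phi 0 g h.
Proof.
split=> H g h pg ph.
  by have [p [pp lp ap]] := H g h pg ph; exists p; rewrite /= pg.
have [p [pp lp /= /andP[_ ap]]] := H g h pg ph.
by exists p.
Qed.

Lemma generates_prod S g : generates S ->
  forall P : G -> Prop, P 1%g -> (forall s x, s \in S -> P x -> P (s * x)%g) ->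
  (forall s x, s \in S -> P x -> P (s^-1 * x)%g) -> P g.
Proof.
move=> /(_ g)[w wS ->] P P1 Ps PV; elim: w wS => [|s w IH] /=.
  by rewrite big_nil.
rewrite big_cons => /andP[/orP[sS|sS] /IH Pw]; first exact: Ps.
by rewrite -(invgK s); apply: PV.
Qed.

Lemma generates_ext S g : generates S -> forall P : G -> Prop,
  P 1%g -> (forall s, s \in S -> P s) -> (forall x y, P x -> P y ->
    P (x * y)%g) ->
  (forall x, P x -> P x^-1%g) -> P g.
Proof.
move=> gS P P1 Ps PM PV; apply: (generates_prod g gS) => // s x sS Px.
  by apply: PM; auto.
by apply: PM => //; apply: PV; auto.
Qed.

(** For the zero character the half-space is the whole Cayley graph, so results on connectivity also
    yield generation. *)
Lemma conn_generates S : (forall g, conn S (fun=> 0) 0 1%g g) -> generates S.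
Proof.
move=> H g; have [p [pp <- _]] := H g.
elim/last_ind: p pp => [|p x IH]; first by exists [::]; rewrite // big_nil.
rewrite rcons_path last_rcons => /andP[/IH[w wS lE]].
case/hasP=> s sS /orP[]/eqP E.
  by exists (rcons w s); rewrite ?all_rcons ?sS // -cats1 big_cat big_seq1 -lE.
exists (rcons w s^-1%g); rewrite ?all_rcons ?invgK ?sS ?orbT //.
by rewrite -cats1 big_cat big_seq1 /= -lE E mulgK.
Qed.

Lemma generates_conn S g h : generates S -> conn S (fun=> 0) 0 g h.
Proof.
move=> gS; rewrite -[h](mulVKg g).
apply: (generates_prod (g^-1 * h)%g gS (P := fun x => forall g,
  conn S (fun=> 0) 0 g (g * x)%g)).
- by move=> x; rewrite mulg1; apply: conn_refl.
- by move=> s x sS H y; rewrite mulgA; apply: conn_trans (H _); apply: conn_gen.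
- by move=> s x sS H y; rewrite mulgA; apply: conn_trans (H _);
    apply: conn_genV.
Qed.

Section Hom.
Variable phi : G -> R.
Hypothesis phiM : realHom R G phi.

Lemma conn_mull S L z g h :
  conn S phi L g h -> conn S phi (phi z + L) (z * g)%g (z * h)%g.
Proof.
move=> [p [pp <- ap]]; exists (map (fun x => z * x)%g p); split.
- rewrite path_map; apply: sub_path pp => x y /hasP[s sS xy].
  by apply/hasP; exists s => //=; rewrite -!mulgA !(inj_eq (mulgI z)).
- exact: last_map.
- rewrite -[_ :: _]/(map (fun x => z * x)%g (g :: p)) all_map.
  by apply: sub_all ap => x /= Lx; rewrite phiM lerD2l.
Qed.

Lemma realHom_pos : nonzero phi -> exists t, 0 < phi t.
Proof.
move=> [x px]; have [p0|n0|/eqP] := ltgtP (phi x) 0; last by rewrite (negPf px).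
  by exists x^-1%g; rewrite realHomV // oppr_gt0.
by exists x.
Qed.

Lemma realHom_ge r : nonzero phi -> exists z, r <= phi z.
Proof.
case/realHom_pos=> t t0; exists (t ^+ (Num.truncn (r / phi t)).+1)%g.
rewrite realHomX // -mulr_natl -ler_pdivrMr //; apply/ltW/truncnS_gt.
Qed.

(** The values of the powers of [t] are spaced by [phi t]. Truncation applies to nonnegative
    numbers, so negative [r] is treated with powers of the inverse. *)
Lemma realHom_approx t r : 0 < phi t -> exists z, r <= phi z <= r + phi t.
Proof.
move=> t0; have [r0|r0] := leP 0 r.
  exists (t ^+ (Num.truncn (r / phi t)).+1)%g; rewrite realHomX // -mulr_natl.
  rewrite -ler_pdivrMr // (ltW (truncnS_gt _)) /= -natr1 mulrDl mul1r lerD2r.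
  by rewrite -ler_pdivlMr // truncn_le ?divr_ge0 // ltW.
exists (t ^- (Num.truncn (- r / phi t)))%g;
  rewrite realHomV // realHomX // -mulr_natl.
have r0' : 0 <= - r / phi t by rewrite divr_ge0 ?oppr_ge0 ?ltW.
apply/andP; split; first by rewrite lerNr -ler_pdivlMr // truncn_le.
have := ltW (truncnS_gt (- r / phi t)).
rewrite ler_pdivrMr // -natr1 mulrDl mul1r; lra.
Qed.

(** Left translation moves level [L] near level [0]; the levels reached by powers of [t] are
    discrete, which costs at most [phi t]. *)
Lemma half_connected_level S : cay_half_connected S phi ->
  exists2 M, 0 <= M & forall L g h, L <= phi g -> L <= phi h ->
    conn S phi (L - M) g h.
Proof.
move=> /cay_half_connectedP H.
have [[t t0]|] := pselect (exists t, 0 < phi t); last first.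
  move=> n; have phi0 x : phi x = 0.
    have [e|] := eqVneq (phi x) 0; first by [].
    by move=> e; case: n; apply: realHom_pos; exists x.
  exists 0 => // L g h; rewrite subr0 => Lg Lh; apply: (@conn_le _ _ 0).
    by rewrite -(phi0 g).
  by apply: H; rewrite phi0.
exists (phi t); first exact: ltW.
move=> L g h Lg Lh; have [z /andP[z1 z2]] := realHom_approx (- L) t0.
have zx x : L <= phi x -> 0 <= phi (z * x)%g.
  by move=> Lx; rewrite phiM -(subrr (phi z)) lerD2l (le_trans _ Lx) // lerNl.
have := conn_mull z^-1%g (H _ _ (zx g Lg) (zx h Lh)); rewrite !mulKg.
by apply: conn_le; rewrite addr0 realHomV // lerNr opprB addrC.
Qed.

(** Both points first climb along a generator of positive value; a path that dips to depth [M] below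
    the new level then stays in the half-space. *)
Lemma half_connected_weak S M : generates S -> nonzero phi ->
  (forall g h, 0 <= phi g -> 0 <= phi h -> conn S phi M g h) ->
  cay_half_connected S phi.
Proof.
move=> gS nz H; apply/cay_half_connectedP => g h g0 h0.
(* If no generator or inverse of one had positive value, [phi] would vanish on [S], hence
   everywhere. *)
have [t [t0 tS]] : exists t, 0 < phi t /\ (t \in S \/ t^-1%g \in S).
  apply: contrapT => n; case: nz => x; apply/negP; rewrite negbK.
  have S0 s : s \in S -> phi s = 0.
    move=> sS; apply: contrapT => /eqP; have [p0|p0|//] := ltgtP (phi s) 0.
    - by case: n; exists s^-1%g; rewrite realHomV // oppr_gt0 p0 invgK; auto.
    - by case: n; exists s; auto.
  apply/eqP; apply: (@generates_ext S x gS (fun y => phi y = 0)) => //;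
    first exact: realHom1.
    by move=> y z py pz; rewrite phiM py pz addr0.
  by move=> y py; rewrite realHomV // py oppr0.
have up n x : 0 <= phi x -> conn S phi 0 x (x * t ^+ n)%g.
  move=> x0; elim: n => [|n IH]; first by rewrite expg0 mulg1; apply: conn_refl.
  apply: conn_trans IH _; rewrite expgSr mulgA.
  have y0 : 0 <= phi (x * t ^+ n)%g.
    by rewrite phiM realHomX // addr_ge0 // mulrn_wge0 // ltW.
  have y1 : 0 <= phi (x * t ^+ n * t)%g by rewrite phiM addr_ge0 // ltW.
  case: tS => tS; first exact: conn_gen.
  by have := @conn_genV S phi 0 (x * t ^+ n)%g t^-1%g; rewrite invgK; apply.
pose n := (Num.truncn (- M / phi t)).+1.
have Mn : 0 <= phi t *+ n + M.
  rewrite addrC -(subrr M) lerD2l -mulr_natl -ler_pdivrMr //.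
  exact/ltW/truncnS_gt.
apply: conn_trans (up n g g0) _;
  apply/conn_sym/(conn_trans (up n h h0))/conn_sym.
(* Conjugation by [t ^+ n] keeps the level, so [H] joins the conjugates; translating back by
   [t ^+ n] lifts that path to level [phi t *+ n + M]. *)
have lev x : 0 <= phi x -> 0 <= phi (t ^- n * (x * t ^+ n))%g.
  by rewrite !phiM realHomV // addrCA addNr addr0.
have := conn_mull (t ^+ n)%g (H _ _ (lev g g0) (lev h h0)).
by rewrite !mulVKg realHomX //; apply: conn_le.
Qed.
End Hom.

Lemma ray_self phi : ray phi phi.
Proof. by exists 1 => //; apply/funext => x; rewrite mul1r. Qed.

(** Representatives of a ray differ by a positive factor, so they have the same half-space, and
    membership can be tested on [phi] itself. *)
Lemma SigmaP phi : realHom R G phi -> Sigma R G (ray phi) <->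
  nonzero phi /\ exists2 S, generates S & cay_half_connected S phi.
Proof.
move=> pM; split=> [[psi [qM nz [S gS hS]] rE]|[nz [S gS hS]]]; last first.
  by exists phi => //; split=> //; exists S.
have : ray psi phi by rewrite rE; apply: ray_self.
case=> l l0 E; split.
  by case: nz => x px; exists x; rewrite E mulf_neq0 // gt_eqF.
exists S => // g h; rewrite {1 2}E !pmulr_rge0 // => g0 h0.
have [p [pp lp ap]] := hS g h g0 h0; exists p; split=> //.
by apply: sub_all ap => x x0; rewrite E pmulr_rge0.
Qed.

Lemma char_sphereP phi : char_sphere R G (ray phi) <-> realHom R G phi /\
  nonzero phi.
Proof.
split=> [[psi [qM [x nz]] rE]|]; last by exists phi.
have : ray psi phi by rewrite rE; apply: ray_self.
case=> l l0 ->; split; first by move=> g h; rewrite qM mulrDr.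
by exists x; rewrite mulf_neq0 // gt_eqF.
Qed.
End Connected.

Section ConnMap.
Variables (R : realType) (G H : groupType) (f : H -> G).
Hypothesis fM : {morph f : x y / (x * y)%g}.

Lemma conn_map S S' (phi : G -> R) L g h : {subset map f S <= S'} ->
  conn S (fun x => phi (f x)) L g h -> conn S' phi L (f g) (f h).
Proof.
move=> SS [p [pp <- ap]]; exists (map f p); split.
- rewrite path_map; apply: sub_path pp => x y /hasP[s sS xy].
  apply/hasP; exists (f s); first exact/SS/map_f.
  by case/orP: xy => /eqP ->; rewrite fM eqxx ?orbT.
- exact: last_map.
- by rewrite -[_ :: _]/(map f (g :: p)) all_map.
Qed.

Lemma realHom_comp (phi : G -> R) :
  realHom R G phi -> realHom R H (fun x => phi (f x)).
Proof. by move=> pM x y; rewrite fM pM. Qed.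
End ConnMap.

(** * Characters that vanish on an edge group *)

Section Restriction.
Variables (R : realType) (GG : graph_of_groups) (T : {set edge GG}).
Variable phi : pi1 T -> R.
Hypothesis phiM : realHom R (pi1 T) phi.

Lemma realHom_oincl (a : oedge GG) (c : egroup a.1) :
  phi (vincl T (oincl c)) = phi (eincl T c).
Proof.
case: a c => e [] c //=.
have /(congr1 phi) := vincl_oincl T (a := (e, false)) c.
by rewrite !phiM addrC => /addrI.
Qed.

Lemma word_prefix_bound (w : word GG) : exists2 B : R, 0 <= B &
  forall w1 w2, w = w1 ++ w2 -> - B <= phi (wclass T w1).
Proof.
elim: w => [|l w [B B0 H]].
  by exists 0 => // [] [|? ?] // w2 _; rewrite wclass_nil (realHom1 phiM) oppr0.
exists (`|phi (lclass T l)| + B); first exact: addr_ge0.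
move=> [|l1 w1] w2 => [_|[<- /H h]].
  by rewrite wclass_nil (realHom1 phiM) oppr_le0 addr_ge0.
by rewrite wclass_cons phiM opprD lerD // lerNl -normrN ler_norm.
Qed.

Lemma gens_prefix_bound (S : seq (pi1 T)) : exists2 B : R, 0 <= B &
  forall s w1 w2, s \in S -> repr s = w1 ++ w2 -> - B <= phi (wclass T w1).
Proof.
elim: S => [|s S [B B0 H]]; first by exists 0.
have [C C0 HC] := word_prefix_bound (repr s).
exists (B + C); first exact: addr_ge0.
move=> s' w1 w2; rewrite inE => /orP[/eqP -> /HC|sS /(H _ _ _ sS)] => h; lra.
Qed.
End Restriction.

Section TrivialEdge.
Variables (GG : graph_of_groups) (T : {set edge GG}).
Hypothesis treeT : spanning_tree T.
Hypothesis redG : reduced_graph GG.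
Hypothesis nascG : not_ascending_HNN GG.
Implicit Types (a b : oedge GG) (u v : vertex GG) (x y : pi1 T).

(* The edge [a] separates its origin from the vertex [x G_u]. *)
Definition beyond a u x : Prop := dir treeT (oorig a) u x = Some (a, 1%g).

Lemma beyond_leave a b x : dir treeT (oorig a) (oorig b) x = None ->
  beyond a (oterm b) (x * stable T b)%g ->
    exists c, x = vincl T (oincl (a := a) c).
Proof.
move=> /dir_none[g [ba -> _]]; rewrite /beyond dir_leave // => -[E].
by subst b => /coset_rep_emb1[c ->]; exists c.
Qed.

(** The edge [a] is crossed only by a move out of its origin or into it, and then at an element of
    the edge group, which the hypotheses exclude. *)
Lemma beyond_edge a b x :
  ~ (exists c, x = vincl T (oincl (a := a) c)) ->
  ~ (exists c, (x * stable T b)%g = vincl T (oincl (a := a) c)) ->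
  beyond a (oorig b) x <-> beyond a (oterm b) (x * stable T b)%g.
Proof.
move=> nx ny.
have [xn|/eqP xn] := eqVneq (dir treeT (oorig a) (oorig b) x) None.
  split=> [|/(beyond_leave xn)//]; by rewrite /beyond xn.
have [yn|/eqP yn] :=
  eqVneq (dir treeT (oorig a) (oterm b) (x * stable T b)%g) None.
  split=> [xb|]; last by rewrite /beyond yn.
  case: ny; apply: (@beyond_leave a (orev b)); first by rewrite oorig_rev.
  by rewrite oterm_rev stable_rev mulgK.
by rewrite /beyond dir_edge.
Qed.

Lemma edge_path_leave v u p : edge_path v p u -> v <> u ->
  exists f, oorig f = v /\ oterm f <> v.
Proof.
elim: p => [|a p IH] /= in v *; first by move=> /eqP.
case/andP=> /eqP av pu vu; have [E|/eqP n] := eqVneq (oterm a) v;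
  last by exists a.
by apply: IH => //; rewrite -E.
Qed.

Lemma oincl_proper a : oorig a <> oterm a -> ~ onto (@oincl GG a).
Proof.
case: a => e [] /= h; first by have [] := redG (not_eq_sym h).
by have [] := redG h.
Qed.

(** An element of the vertex group outside the edge group moves [a] to another edge at its origin.
    If there is none, the translation detours through a second edge [f] at that vertex. *)
Lemma beyond_disjoint a : exists g : pi1 T,
  forall u x, beyond a u x -> ~ beyond a u (g * x)%g.
Proof.
have [on|/existsNP[h hn]] := pselect (onto (@oincl GG a)); last first.
  exists (vincl T h) => u x; rewrite /beyond dir_mull => ->.
  rewrite mulg1 => -[/coset_rep_emb1[c hc]]; case: hn; by exists c.
have loop : oorig a = oterm a.
  by apply: contrapT => /oincl_proper.
(* If there is another vertex, some [f] leaves towards one, and reducedness makes its group proper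
   at the far end; otherwise the graph has a second loop, because it is not an ascending
   HNN-extension. *)
have [f [fa [ff fo]]] : exists f, oorig f = oorig a /\ f.1 != a.1 /\
    (oterm f = oorig a \/ ~ onto (@oincl GG (orev f))).
  have [[u ua]|all_a] := pselect (exists u, oorig a <> u).
    have [_ /(_ (oorig a) u)[p pu _] _] := treeT.
    have [f [fa fn]] := edge_path_leave pu ua; exists f; split=> //; split.
      apply/eqP => E; apply: fn; move: loop fa; rewrite /oorig /oterm E.
      by case: a.2 f.2 => [] [] // -> .
    by right; apply: oincl_proper; rewrite oorig_rev oterm_rev fa.
  have nH : ~ HNN_extension GG.
    case: nascG => // -[_ /(_ a.1)]; case: (a) on => e [] /= on [] //.
  have V1 u : u = oorig a.
    by apply: contrapT => n; case: all_a; exists u => /esym.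
  have [e ea] : exists e, e != a.1.
    apply: contrapT => n; case: nH; split.
      by apply/eqP/fintype1P; exists (oorig a).
    apply/eqP/fintype1P; exists a.1 => e; apply: contrapT => /eqP ne.
    by case: n; exists e.
  by exists (e, false); split; [exact: V1 | split=> //; left; exact: V1].
have step1 u x : beyond a u x ->
    dir treeT (oorig (orev f)) u (stable T (orev f) * x)%g = Some (orev f, 1%g).
  rewrite /beyond => bx; apply: dir_stable; rewrite oterm_rev fa bx orevK.
  by case=> E; rewrite E eqxx in ff.
case: fo => [fl|/existsNP[b bn]].
  exists (stable T (orev f)) => u x /step1; rewrite oorig_rev fl /beyond => ->.
  by case=> E; rewrite -E eqxx in ff.
(* At the far end of [f], the element [b] prevents the return along [f] from cancelling, so the
   translated vertex is seen through [f], not through [a]. *)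
exists (stable T f * vincl T b * stable T (orev f))%g => u x /step1 bx.
rewrite /beyond -!mulgA -fa dir_stable => [[E]|]; first by rewrite E eqxx in ff.
rewrite -oorig_rev dir_mull bx mulg1 => -[/coset_rep_emb1[c bc]].
by case: bn; exists c.
Qed.

Section Character.
Variables (R : realType) (phi : pi1 T -> R).
Hypothesis phiM : realHom R (pi1 T) phi.

(** Crossing [a] takes place at elements of the edge group, which have level [0], so a path that
    stays high enough remains on one side of [a]. *)
Lemma beyond_high a S (u : vertex GG) :
  (forall c : egroup a.1, phi (eincl T c) = 0) -> cay_half_connected S phi ->
  exists L, forall x y, L <= phi x -> L <= phi y -> beyond a u x ->
    beyond a u y.
Proof.
move=> phi0 hS; have [B B0 HB] := gens_prefix_bound phiM S.
have [M M0 HM] := half_connected_level phiM hS.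
have gen_step z s : s \in S -> B + 1 <= phi z ->
  beyond a u z <-> beyond a u (z * s)%g.
  move=> sS zB; rewrite -[s in (z * s)%g]wclass_repr.
  have pos x : 0 < phi x -> ~ exists c, x = vincl T (oincl (a := a) c).
    by move=> x0 [c xc]; move: x0; rewrite xc realHom_oincl // phi0 ltxx.
  apply: (walk_word treeT (good := fun x => 0 < phi x) (ok := fun=> True)
    (Q := fun x u y v => beyond a u x <-> beyond a v y)) => //.
  - by move=> x v y w z' w' _; apply: iff_trans.
  - by move=> x v h _ _ _; rewrite /beyond dir_vertex.
  - by move=> x b x0 y0; apply: beyond_edge; apply: pos.
  - by move=> w1 w2 /(HB _ _ _ sS) h; rewrite phiM; lra.
(* The path may sink by [M], and a prefix of a generator by [B] more; a margin of [1] keeps every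
   intermediate level positive. *)
exists (B + 1 + M) => x y hx hy.
have := HM _ _ _ hx hy; rewrite addrK => -[p [pp <- ap]] {hx hy}.
elim: p x pp ap => [|z p IH] x //= /andP[xz zp] /and3P[xB zB ap] bx.
apply: IH => //=; first by rewrite zB.
case/hasP: xz => s sS /orP[]/eqP E; first by rewrite E;
  apply/(gen_step x s sS xB).
by apply/(gen_step z s sS zB); rewrite -E.
Qed.

(** Otherwise all high elements would be beyond [a], among them some [z] and [g * z], while [g]
    moves the far side of [a] off itself. *)
Lemma high_not_beyond a S (u : vertex GG) : nonzero phi ->
  (forall c : egroup a.1, phi (eincl T c) = 0) -> cay_half_connected S phi ->
  exists L, forall x, L <= phi x -> ~ beyond a u x.
Proof.
move=> nz phi0 hS; have [L HL] := beyond_high u phi0 hS.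
have [g gP] := beyond_disjoint a; exists L => x xL bx.
have [z zL] := realHom_ge phiM (L + `|phi g|) nz.
have n1 : L <= phi z by have := normr_ge0 (phi g); lra.
have n2 : L <= phi (g * z)%g.
  by rewrite phiM; have := ler_norm (- phi g); rewrite normrN; lra.
by apply: (gP u z); apply: (HL x).
Qed.

Lemma edge_nonzero S : nonzero phi -> cay_half_connected S phi ->
  forall e : edge GG, nonzero (fun c : egroup e => phi (eincl T c)).
Proof.
move=> nz hS e; apply: contrapT => z.
have phi0 (c : egroup e) : phi (eincl T c) = 0.
  by apply: contrapT => /eqP cz; apply: z; exists c.
pose a : oedge GG := (e, false); pose u := src e.
have [L HL] := @high_not_beyond a S u nz phi0 hS.
have [L' HL'] := @high_not_beyond (orev a) S u nz phi0 hS.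
(* The bound puts both [x] and [stable T a * x] above the thresholds. As [x] is not beyond the
   reverse of [a], [dir_stable] puts the translate beyond [a]. *)
have [x xL] := realHom_ge phiM (`|L| + `|L'| + `|phi (stable T a)|) nz.
have := ler_norm L; have := ler_norm L'.
have := ler_norm (- phi (stable T a)); rewrite normrN.
have := normr_ge0 L; have := normr_ge0 L'; have := normr_ge0 (phi (stable T a)).
move=> ? ? ? ? ? ?.
apply: (HL (stable T a * x)%g); first by rewrite phiM; lra.
apply: dir_stable; rewrite -oorig_rev; apply: HL'; lra.
Qed.
End Character.
End TrivialEdge.

(** * Projection to a vertex group *)

Section VertexRetraction.
Variables (R : realType) (GG : graph_of_groups) (T : {set edge GG}).
Hypothesis treeT : spanning_tree T.
Variable phi : pi1 T -> R.
Hypothesis phiM : realHom R (pi1 T) phi.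
Hypothesis edge_half : forall e : edge GG, exists S : seq (egroup e),
  cay_half_connected S (fun c => phi (eincl T c)).
Hypothesis edge_level : forall (e : edge GG) x, exists c : egroup e,
  0 <= phi x + phi (eincl T c).
Implicit Types (a b : oedge GG) (u v : vertex GG) (x y : pi1 T).

Lemma coset_level a v (g : vgroup v) : oorig a = v -> exists k : vgroup v,
  coset_rep a (emb k) = coset_rep a (emb g) /\ 0 <= phi (vincl T k).
Proof.
move=> av; case: v / av g => g; have [c cP] := edge_level a.1 (vincl T g).
exists (g * oincl (a := a) c)%g; rewrite coset_rep_mulr; split=> //.
by rewrite vinclM phiM realHom_oincl.
Qed.

(** Two points of the coset differ by an edge group element; a path from [1] to it in the edge group
    is translated by [k]. The depth lost does not depend on [L]. *)
Lemma coset_conn a v : exists (S : seq (vgroup v)) (M : R), 0 <= M /\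
  (oorig a = v -> forall L (k k' : vgroup v),
    coset_rep a (emb k) = coset_rep a (emb k') ->
    L <= phi (vincl T k) -> L <= phi (vincl T k') ->
    conn S (fun g => phi (vincl T g)) (L - M) k k').
Proof.
have [av|n] := pselect (oorig a = v); last by exists [::], 0; split.
case: v / av; have [S hS] := edge_half a.1.
have eM : realHom R (egroup a.1) (fun c => phi (eincl T c)).
  move=> c d /=; rewrite -!(realHom_oincl phiM (a := a)) oinclM vinclM;
    exact: phiM.
have vM : realHom R (vgroup (oorig a)) (fun g => phi (vincl T g)).
  by apply: realHom_comp => [? ?|]; [apply: vinclM | apply: phiM].
have [M M0 HM] := half_connected_level eM hS.
exists (map (@oincl GG a) S), M; split=> // _ L k k' /coset_rep_eq[c ->] Lk Lk'.
have := HM (L - phi (vincl T k)) 1%g c; rewrite (realHom1 eM) => H.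
have {H} : conn S (fun c => phi (eincl T c)) (L - phi (vincl T k) - M) 1%g c.
  apply: H.
    by rewrite subr_le0.
  by rewrite lerBlDl -(realHom_oincl phiM (a := a)) -phiM -vinclM.
have -> : (fun c => phi (eincl T c)) =
    (fun c : egroup a.1 => phi (vincl T (oincl c))).
  by apply/funext => d; rewrite realHom_oincl.
move=> /(conn_map (@oinclM GG a) (S' := map (@oincl GG a) S)
  (phi := fun g => phi (vincl T g)) (fun _ => id)).
move=> /(conn_mull vM k); rewrite (morph_mul1 (@oinclM GG a)) mulg1.
by rewrite addrA addrCA subrr addr0.
Qed.

Variable v : vertex GG.

Lemma cosets_conn : exists (S : seq (vgroup v)) (M : R), 0 <= M /\
  forall a, oorig a = v -> forall L (k k' : vgroup v),
    coset_rep a (emb k) = coset_rep a (emb k') ->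
    L <= phi (vincl T k) -> L <= phi (vincl T k') ->
    conn S (fun g => phi (vincl T g)) (L - M) k k'.
Proof.
have /choice[S /choice[M MP]] := fun a => coset_conn a v.
exists (flatten [seq S a | a <- enum {: oedge GG}]), (\sum_a M a); split.
  by apply: sumr_ge0 => a _; have [] := MP a.
move=> a av L k k' kk Lk Lk'; have [M0 /(_ av L k k' kk Lk Lk') c] := MP a.
apply: (@conn_le _ _ _ _ (L - M a)).
  rewrite lerD2l lerN2 (bigD1 a) //= lerDl; apply: sumr_ge0 => b _.
  by have [] := MP b.
apply: (conn_map (f := id) _ _ c) => // g; rewrite map_id => gS.
by apply/flattenP; exists (S a) => //; apply: map_f; rewrite mem_enum.
Qed.

Lemma vertex_letters (w : word GG) : exists S : seq (vgroup v),
  forall h : vgroup v, vletter h \in w -> h \in S.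
Proof.
elim: w => [|l w [S HS]]; first by exists [::].
have [[h lh]|n] := pselect (exists h : vgroup v, l = vletter h).
  exists (h :: S) => h'; rewrite lh !inE => /orP[/eqP[/eqP]|/HS ->];
    last by rewrite orbT.
  by rewrite eq_Tagged /= => ->.
exists S => h; rewrite inE => /orP[/eqP E|]; last exact: HS.
by case: n; exists h.
Qed.

Lemma gens_letters (S : seq (pi1 T)) : exists S' : seq (vgroup v),
  forall s (h : vgroup v), s \in S -> vletter h \in repr s -> h \in S'.
Proof.
elim: S => [|s S [S1 HS1]]; first by exists [::].
have [S2 HS2] := vertex_letters (repr s); exists (S1 ++ S2) => s' h.
by rewrite inE mem_cat => /orP[/eqP ->/HS2 ->|sS /(HS1 _ _ sS) ->];
  rewrite ?orbT.
Qed.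

(* [near u x k]: [k] lies in the projection to the vertex group of [v] of the
   vertex [x G_u] of the Bass-Serre tree, which is a single element or a coset
   of an edge group. *)
Definition near u x (k : vgroup v) : Prop :=
  (u = v /\ x = vincl T k) \/
  exists2 a, oorig a = v & dir treeT v u x = Some (a, coset_rep a (emb k)).

Lemma near_vertex u x k : near u x k -> dir treeT v u x = None ->
  u = v /\ x = vincl T k.
Proof. by case=> [//|[a _ ->]]. Qed.

(** A coset is only known to meet level [0], hence the condition on [L]; a single element has the
    level of [x]. *)
Lemma near_exists u x L : L <= 0 -> L <= phi x ->
  exists2 k, near u x k & L <= phi (vincl T k).
Proof.
move=> L0 Lx; case dE: (dir treeT v u x) => [[a k]|].
  have [av [g kg]] := dir_some dE.
  have [h [hg h0]] := coset_level g av; exists h; last exact: le_trans h0.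
  by right; exists a => //; rewrite dE kg hg.
by have [g [uv xg _]] := dir_none dE; exists g; [left | rewrite -xg].
Qed.

Definition same_coset (k k' : vgroup v) : Prop :=
  k = k' \/ exists2 a, oorig a = v & coset_rep a (emb k) = coset_rep a (emb k').

Lemma near_near u x k k' : near u x k -> near u x k' -> same_coset k k'.
Proof.
case=> [[uv xk]|[a av dE]] [[uv' xk']|[b bv dE']].
- by left; apply: (vincl_inj treeT); rewrite -xk.
- by move: dE'; rewrite uv xk dir_vincl.
- by move: dE; rewrite uv' xk' dir_vincl.
- by right; exists a => //; move: dE'; rewrite dE => -[<-].
Qed.

(** Leaving or entering the vertex of [v] along [b] joins a point to a coset containing it;
    elsewhere the direction from [v] does not change. *)
Lemma near_edge b x k k' : near (oorig b) x k ->
  near (oterm b) (x * stable T b)%g k' -> same_coset k k'.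
Proof.
case=> [[uv xk]|[a av dE]] [[uv' xk']|[c cv dE']].
- by have := dir_leave treeT k uv; rewrite -xk uv' xk' dir_vincl.
- right; exists b => //; move: dE'; rewrite xk dir_leave // => -[<-]; exact.
- have : dir treeT v (oterm (orev b)) (vincl T k' * stable T (orev b))%g =
    Some (orev b, coset_rep (orev b) (emb k')).
    by apply: dir_leave; rewrite oorig_rev.
  rewrite -xk' stable_rev mulgK oterm_rev dE => -[-> rE].
  by right; exists (orev b); rewrite // oorig_rev.
- have n : dir treeT v (oterm b) (x * stable T b)%g <> None by rewrite dE'.
  by right; exists a => //; move: dE'; rewrite dir_edge ?dE // => -[<-].
Qed.

(** A path in [G] is refined to the letters of its generators and projected. The projection moves
    inside cosets of edge groups, except at letters read at the vertex of [v] itself, which are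
    collected in [S2]. *)
Lemma vertex_half S : cay_half_connected S phi ->
  exists (S' : seq (vgroup v)) (M : R), forall g h : vgroup v,
  0 <= phi (vincl T g) -> 0 <= phi (vincl T h) ->
  conn S' (fun g => phi (vincl T g)) M g h.
Proof.
move=> /cay_half_connectedP hS.
have [B B0 HB] := gens_prefix_bound phiM S.
have [S1 [M [M0 HM]]] := cosets_conn.
have [S2 HS2] := gens_letters S.
pose L := - B; pose S' := S1 ++ S2.
(* All projections of level at least [L] are allowed, so segments can be glued at any point given by
   [near_exists]; [L] is the lowest level of a prefix starting in the half-space. *)
pose Q x u y w := forall k k', near u x k -> near w y k' ->
  L <= phi (vincl T k) -> L <= phi (vincl T k') ->
  conn S' (fun g => phi (vincl T g)) (L - M) k k'.
have L0 : L <= 0 by rewrite oppr_le0.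
have cc k k' : same_coset k k' ->
    L <= phi (vincl T k) -> L <= phi (vincl T k') ->
    conn S' (fun g => phi (vincl T g)) (L - M) k k'.
  case=> [<- Lk _|[a av kk] Lk Lk']; first by apply: conn_refl; lra.
  apply: (conn_map (f := id) _ _ (HM a av L k k' kk Lk Lk')) => // g.
  by rewrite map_id mem_cat => ->.
have Qrefl x u : L <= phi x -> Q x u x u.
  by move=> _ k k' nk nk'; apply: cc; apply: near_near nk nk'.
have Qtrans x u y w z t : L <= phi y -> Q x u y w -> Q y w z t -> Q x u z t.
  move=> Ly q1 q2 k k' nk nk' Lk Lk'; have [h nh Lh] := near_exists w L0 Ly.
  exact: conn_trans (q1 k h nk nh Lk Lh) (q2 h k' nh nk' Lh Lk').
have Qsym x u y w : Q x u y w -> Q y w x u.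
  by move=> q k k' nk nk' Lk Lk'; apply/conn_sym/q.
have Qgen x s : s \in S -> 0 <= phi x -> Q x v (x * s)%g v.
  move=> sS x0; rewrite -[s in (x * s)%g]wclass_repr.
  apply: (walk_word treeT (good := fun x => L <= phi x)
    (ok := fun l => forall h : vgroup v, l = vletter h -> h \in S2)) => //.
  - move=> y u h okh Ly Lyh k k' nk nk' Lk Lk'.
    have [dN|/eqP dS] := eqVneq (dir treeT v u y) None; last first.
      apply: (cc _ _ _ Lk Lk'); apply: (@near_near u y) => //.
      case: nk' => [[uv yk]|[a av dE]].
        by case: dS; rewrite -(dir_vertex treeT v y h) yk uv dir_vincl.
      by right; exists a => //; rewrite -(dir_vertex treeT v y h).
    have [uv yk] := near_vertex nk dN.
    have [_ yk'] : u = v /\ (y * vincl T h)%g = vincl T k'.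
      by apply: near_vertex nk' _; rewrite dir_vertex.
    move/esym: uv => uv; case: u / uv h okh Lyh nk nk' dN yk' =>
      h okh Lyh nk nk' dN yk'.
    have -> : k' = (k * h)%g.
      by apply: (vincl_inj treeT); rewrite -yk' yk vinclM.
    apply: conn_gen; first by rewrite mem_cat (okh h) ?orbT.
      by lra.
    by rewrite -yk in Lk *; rewrite vinclM -yk; lra.
  - by move=> y b _ _ k k' nk nk'; apply: cc; apply: near_edge nk nk'.
  - by move=> l lw h lh; apply: HS2 sS _; rewrite -lh.
  - by move=> w1 w2 /(HB _ _ _ sS) h; rewrite phiM /L; lra.
exists S', (L - M) => g h g0 h0.
have [p [pp lp ap]] := hS _ _ g0 h0.
suff : Q (vincl T g) v (vincl T h) v by apply; [left|left|lra|lra].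
rewrite -lp; elim: p (vincl T g) pp ap {lp} => [|y p IH] x /=.
  by move=> _ /andP[x0 _]; apply: Qrefl; lra.
move=> /andP[xy yp] /and3P[x0 y0 ap]; apply: (Qtrans _ _ y v); first by lra.
  case/hasP: xy => s sS /orP[]/eqP ->; first exact: Qgen.
  by apply: Qsym; apply: Qgen.
by apply: IH => //=; rewrite y0.
Qed.
End VertexRetraction.

(** * Characters that are nonzero on all edge groups *)

Section FromVertices.
Variables (R : realType) (GG : graph_of_groups) (T : {set edge GG}).
Hypothesis treeT : spanning_tree T.
Variable phi : pi1 T -> R.
Hypothesis phiM : realHom R (pi1 T) phi.
Hypothesis phi0 : nonzero phi.
Hypothesis phi_edge : forall e : edge GG,
  nonzero (fun c : egroup e => phi (eincl T c)).
Implicit Types (a b : oedge GG) (u v : vertex GG) (x y : pi1 T).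

Lemma realHom_vincl v : realHom R (vgroup v) (fun g => phi (vincl T g)).
Proof. by apply: realHom_comp => [? ?|]; [apply: vinclM | apply: phiM]. Qed.

Lemma realHom_eincl (e : edge GG) :
  realHom R (egroup e) (fun c => phi (eincl T c)).
Proof.
by apply: realHom_comp => [c d|]; [rewrite /eincl gmulfM vinclM | apply: phiM].
Qed.

(** An edge at [v] supplies a nonzero value. Without one, connectedness makes [v] the only vertex,
    and its group is all of [G]. *)
Lemma vertex_nonzero v : nonzero (fun g : vgroup v => phi (vincl T g)).
Proof.
have [[a av]|n] := pselect (exists a, oorig a = v).
  case: v / av; have [c cP] := phi_edge a.1.
  by exists (oincl (a := a) c); rewrite realHom_oincl.
have all_v u : v = u.
  apply: contrapT => vu; have [_ /(_ v u)[p pu _] _] := treeT.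
  by have [f [fv _]] := edge_path_leave pu vu; apply: n; exists f.
apply: contrapT => z; case: phi0 => x; rewrite (_ : phi x = 0) ?eqxx //.
apply: (@pi1_ind GG T (fun x => phi x = 0) _ _ _ x) => [|u g {}x px|a {}x px].
- exact: realHom1.
- rewrite phiM px addr0; apply: contrapT => /eqP; case: u / (all_v u) g => g gz.
  by apply: z; exists g.
- by case: n; exists a; apply/esym/all_v.
Qed.

Hypothesis phi_vertex : forall v, exists2 S : seq (vgroup v), generates S &
  cay_half_connected S (fun g => phi (vincl T g)).

(** Cosets of vertex groups are connected at depth [M], and a walk in the tree chains them together;
    [half_connected_weak] then removes the depth. *)
Lemma half_of_vertices : exists2 S, generates S & cay_half_connected S phi.
Proof.
have H v : exists S : seq (vgroup v), generates S /\
    cay_half_connected S (fun g => phi (vincl T g)).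
  by have [S] := phi_vertex v; exists S.
pose Sv v := sval (cid (H v)).
have SvP v : generates (Sv v) /\
    cay_half_connected (Sv v) (fun g => phi (vincl T g)).
  exact: svalP (cid (H v)).
pose S := flatten [seq map (@vincl GG T v) (Sv v) | v <- enum {: vertex GG}] ++
  [seq stable T (e, false) | e <- enum {: edge GG}].
have vS v : {subset map (@vincl GG T v) (Sv v) <= S}.
  move=> x xS; rewrite mem_cat; apply/orP; left; apply/flattenP.
  exists (map (@vincl GG T v) (Sv v)) => //.
  by apply/mapP; exists v; rewrite ?mem_enum.
have eS a x : cay_adj S x (x * stable T a)%g.
  have h e : stable T (e, false) \in S.
    by rewrite mem_cat; apply/orP; right; apply/mapP; exists e;
      rewrite ?mem_enum.
  apply/hasP; exists (stable T (a.1, false)) => //; case: a => e [] /=.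
    by rewrite -[(e, true)]/(orev (e, false)) stable_rev mulgVK eqxx orbT.
  by rewrite eqxx.
have gS : generates S.
  apply: (@conn_generates R) => x; rewrite -[x]mul1g.
  move: {1 2}1%g; apply: (@pi1_ind GG T
    (fun x => forall y, conn S (fun=> 0 : R) 0 y (y * x)%g) _ _ _ x)
    => [|v g {}x IH|a {}x IH] y.
  - by rewrite mulg1; apply: conn_refl.
  - rewrite mulgA; apply: conn_trans (IH _).
    have := generates_conn R 1%g g (SvP v).1.
    move=> /(conn_map (@vinclM GG T v) (phi := fun=> 0) (vS v)).
    rewrite vincl1 => /(conn_mull (phi := fun=> 0) _ y).
    by rewrite mulg1 addr0; apply=> ? ?; rewrite addr0.
  - by rewrite mulgA; apply: conn_trans (IH _); apply: conn_adj.
exists S => //.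
have [M M0 HM] : exists2 M, 0 <= M & forall v x (k k' : vgroup v),
    0 <= phi (x * vincl T k)%g -> 0 <= phi (x * vincl T k')%g ->
    conn S phi (- M) (x * vincl T k)%g (x * vincl T k')%g.
  have /choice[M MP] : forall v, exists M : R, 0 <= M /\
      forall L (g h : vgroup v),
      L <= phi (vincl T g) -> L <= phi (vincl T h) ->
      conn (Sv v) (fun g => phi (vincl T g)) (L - M) g h.
    move=> v.
    have [M M0 HM] := half_connected_level (@realHom_vincl v) (SvP v).2.
    by exists M.
  exists (\sum_v M v); first by apply: sumr_ge0 => v _; have [] := MP v.
  move=> v x k k'; rewrite !phiM => k0 k0'.
  have c1 : - phi x <= phi (vincl T k) by lra.
  have c2 : - phi x <= phi (vincl T k') by lra.
  have := conn_map (@vinclM GG T v) (vS v) ((MP v).2 _ _ _ c1 c2).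
  move=> /(conn_mull phiM x).
  apply: conn_le; rewrite addrA subrr add0r lerN2 (bigD1 v) //= lerDl.
  by apply: sumr_ge0 => u _; have [] := MP u.
pose Q x u y w := forall (k : vgroup u) (k' : vgroup w),
  0 <= phi (x * vincl T k)%g -> 0 <= phi (y * vincl T k')%g ->
  conn S phi (- M) (x * vincl T k)%g (y * vincl T k')%g.
have QE x u y w : Q x u y w.
  rewrite -(mulVKg x y) -[(x^-1 * y)%g]wclass_repr.
  apply: (walk_word treeT (good := fun=> True) (ok := fun=> True)
    (Q := Q)) => //.
  - by move=> x' u' _ k k'; apply: HM.
  - move=> x1 u1 x2 u2 x3 u3 _ q1 q2 k k' k0 k0'.
    have [h hP] :=
      realHom_ge (@realHom_vincl u2) (- phi x2) (vertex_nonzero u2).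
    have h0 : 0 <= phi (x2 * vincl T h)%g by rewrite phiM; lra.
    exact: conn_trans (q1 k h k0 h0) (q2 h k' h0 k0').
  - move=> x' u' h _ _ _ k k'; rewrite -!mulgA -vinclM; apply: HM.
  - move=> x' a _ _ k k' k0 k0'.
    (* The level of [c] is high enough on both sides of the edge: it compensates [x'] and also a
       possible drop along [stable T a]. *)
    have [c cP] := realHom_ge (@realHom_eincl a.1)
      (- phi x' + `|phi (stable T a)|) (phi_edge a.1).
    have := normr_ge0 (phi (stable T a)); have := ler_norm (- phi (stable T a)).
    rewrite normrN => n1 n2.
    have p1 : 0 <= phi (x' * vincl T (oincl (a := a) c))%g.
      by rewrite phiM realHom_oincl //; lra.
    have p2 : 0 <= phi (x' * vincl T (oincl (a := a) c) * stable T a)%g.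
      by rewrite !phiM realHom_oincl //; lra.
    have E : (x' * vincl T (oincl (a := a) c) * stable T a)%g =
        (x' * stable T a * vincl T (oincl' (a := a) c))%g.
      by rewrite -!mulgA vincl_oincl.
    apply: conn_trans (HM _ _ _ _ k0 p1) _.
    apply: (@conn_trans _ _ _ _ _
      (x' * vincl T (oincl (a := a) c) * stable T a)%g).
      by apply: conn_adj (eS _ _) _ _; lra.
    by rewrite E; apply: HM; rewrite -?E.
apply: (@half_connected_weak _ _ _ phiM S (- M)) => // g h g0 h0.
have [/card_gt0P[v _] _ _] := treeT.
by have := QE g v h v 1%g 1%g; rewrite vincl1 !mulg1; apply.
Qed.
End FromVertices.

(** * Rational subspheres *)

Section Rational.
Variables (R : realType) (G : groupType).
Implicit Types (phi : G -> R).

(** The family [c] is a shortest one whose rational span contains [X]; minimality gives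
    independence, since a relation would express one member by the others. *)
Lemma min_rat_span (X : seq R) : exists n (c : 'I_n -> R),
  (forall x, x \in X -> exists q : 'I_n -> rat, x = \sum_i c i * ratr (q i)) /\
  (forall q : 'I_n -> rat, \sum_i c i * ratr (q i) = 0 -> forall i, q i = 0).
Proof.
pose span n := exists c : 'I_n -> R, forall x, x \in X ->
  exists q : 'I_n -> rat, x = \sum_i c i * ratr (q i).
have ex : exists n, `[< span n >].
  exists (size X); apply/asboolP; exists (fun i => nth 0 X i) => x xX.
  have iX : (index x X < size X)%N by rewrite index_mem.
  exists (fun i => (i == Ordinal iX)%:R).
  rewrite (bigD1 (Ordinal iX)) //= eqxx rmorph1 mulr1 nth_index //.
  rewrite big1 ?addr0 //.
  by move=> i /negPf ->; rewrite rmorph0 mulr0.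
case: (ex_minnP ex) => n /asboolP[c cP] min; exists n, c; split=> // q q0 k.
apply: contrapT => /eqP qk;
  case: n c cP min q q0 k qk => [|n] c cP min q q0 k qk.
  by case: k qk.
suff /asboolP/min : span n by rewrite ltnn.
exists (fun i => c (lift k i)) => x /cP[p ->].
have rk : ratr (q k) != 0 :> R by rewrite fmorph_eq0.
exists (fun i => p (lift k i) - p k * q (lift k i) / q k).
move: q0; rewrite !(bigD1_ord k) //= => /eqP; rewrite addr_eq0 => /eqP ck.
have {}ck : c k =
    - (\sum_(i < n) c (lift k i) * ratr (q (lift k i))) / ratr (q k).
  by rewrite -ck mulfK.
rewrite {1}ck -mulrA mulNr mulr_suml -sumrN -big_split;
  apply: eq_bigr => i _ /=.
rewrite rmorphB fmorph_div rmorphM /= mulrBr addrC; congr (_ - _).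
move: (ratr (q (lift k i)) : R) (ratr (q k) : R) (ratr (p k) : R) => A B D.
by rewrite -!mulrA; congr (_ * _); rewrite [_^-1 * _]mulrC mulrCA.
Qed.

(** Coordinates of the values of [phi] in a rationally independent family are unique, hence
    additive, and they vanish where [phi] does. *)
Lemma realHom_rat phi : realHom R G phi -> finitely_generated G ->
  exists n (c : 'I_n -> R) (q : 'I_n -> G -> rat),
  [/\ forall i, {morph q i : x y / (x * y)%g >-> x + y},
      forall i x, phi x = 0 -> q i x = 0
    & phi = (fun x => \sum_(i < n) c i * ratr (q i x))].
Proof.
move=> phiM [S gS]; have [n [c [spanS indep]]] := min_rat_span (map phi S).
have /choice[q qP] : forall x, exists q : 'I_n -> rat,
    phi x = \sum_i c i * ratr (q i).
  move=> x; apply: (@generates_ext _ S x gS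
    (fun x => exists q : 'I_n -> rat, phi x = \sum_i c i * ratr (q i))).
  - exists (fun=> 0); rewrite (realHom1 phiM) big1 // => i _.
    by rewrite rmorph0 mulr0.
  - by move=> s sS; apply: spanS; apply: map_f.
  - move=> y z [p pE] [r rE]; exists (fun i => p i + r i).
    by rewrite phiM pE rE -big_split; apply: eq_bigr => i _;
      rewrite /= rmorphD mulrDr.
  - move=> y [p pE]; exists (fun i => - p i).
    by rewrite realHomV // pE -sumrN; apply: eq_bigr => i _;
      rewrite rmorphN mulrN.
have q_uniq x (p : 'I_n -> rat) :
  phi x = \sum_i c i * ratr (p i) -> forall i, q x i = p i.
  move=> pE i; apply/eqP; rewrite -subr_eq0; apply/eqP;
    apply: (indep (fun i => q x i - p i)).
  rewrite (eq_bigr (fun i => c i * ratr (q x i) - c i * ratr (p i))).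
    by rewrite sumrB -qP -pE subrr.
  by move=> j _; rewrite rmorphB mulrBr.
exists n, c, (fun i x => q x i); split.
- move=> i x y; apply: (q_uniq _ (fun i => q x i + q y i)).
  by rewrite phiM !qP -big_split; apply: eq_bigr => j _;
    rewrite /= rmorphD mulrDr.
- move=> i x x0; apply: (q_uniq _ (fun=> 0)); rewrite x0 big1 // => j _.
  by rewrite rmorph0 mulr0.
- by apply/funext.
Qed.

Lemma annihilator_rat (A : set G) : finitely_generated G ->
  let W := [set phi | realHom R G phi /\ forall x, A x -> phi x = 0] in
  linear_subspace W /\ defined_over_rat W.
Proof.
move=> fgG W; split.
  split; first by move=> phi [].
  - by split=> // x y; rewrite addr0.
  - move=> a phi psi [phiM phi0] [psiM psi0]; split=> [x y|x Ax].
      by rewrite phiM psiM mulrDr addrACA.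
    by rewrite phi0 // psi0 // mulr0 addr0.
move=> phi [phiM phi0]; have [n [c [q [qM q0 E]]]] := realHom_rat phiM fgG.
exists n, c, q; split=> // i; split=> [x y|x Ax]; first by rewrite qM rmorphD.
by rewrite q0 ?rmorph0 // phi0.
Qed.
End Rational.

(** * Criteria for membership in Sigma, and the shape of Sigma *)

Section Criterion.
Variables (R : realType) (GG : graph_of_groups) (T : {set edge GG}).
Hypothesis treeT : spanning_tree T.
Local Notation G := (pi1 T).
Implicit Types phi : G -> R.

Lemma vertex_Sigma phi (v : vertex GG) :
  (forall e : edge GG, class_varsigma R (egroup e)) ->
  realHom R G phi -> nonzero phi ->
  (forall e : edge GG, nonzero (fun c : egroup e => phi (eincl T c))) ->
  Sigma R G (ray phi) -> Sigma R (vgroup v) (ray (fun g => phi (vincl T g))).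
Proof.
move=> edgeS phiM nz nze /(SigmaP phiM)[_ [S gS hS]].
have vM : realHom R (vgroup v) (fun g => phi (vincl T g)).
  exact: realHom_vincl.
apply/(SigmaP vM); split; first exact: (vertex_nonzero treeT).
(* The zero character makes [vertex_half] a statement on finite generation: edge groups are finitely
   generated, hence so is the group of [v]. *)
have [||||S1 [M1 HM1]] := @vertex_half R GG T treeT (fun=> 0) _ _ _ v S.
- by move=> ? ?; rewrite addr0.
- move=> e; have [[Se gSe] _] := edgeS e; exists Se.
  by apply/cay_half_connectedP => g h _ _; apply: generates_conn.
- by move=> e x; exists 1%g; rewrite addr0.
- by apply/cay_half_connectedP => g h _ _; apply: generates_conn.
(* For [phi] itself, the class varsigma makes the half-spaces of edge groups connected, because
   [phi] is nonzero on them. *)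
have [|||S2 [M2 HM2]] := @vertex_half R GG T treeT phi phiM _ _ v S.
- move=> e; have [_ SE] := edgeS e; have eM := realHom_eincl phiM (e := e).
  have : char_sphere R (egroup e) (ray (fun c => phi (eincl T c))).
    by apply/char_sphereP.
  by rewrite -SE => /(SigmaP eM)[_ [Se _ hSe]]; exists Se.
- move=> e x.
  have [c cP] := realHom_ge (realHom_eincl phiM (e := e)) (- phi x) (nze e).
  by exists c; rewrite -(subrr (phi x)) lerD2l.
- exact: hS.
have gS12 : generates (S1 ++ S2).
  apply: (@conn_generates R) => g;
    have [p [pp lp _]] := HM1 1%g g (lexx 0) (lexx 0).
  exists p; split=> //; last by apply/allP.
  apply: sub_path pp => x y /hasP[s sS xy]; apply/hasP; exists s => //.
  by rewrite mem_cat sS.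
exists (S1 ++ S2) => //; apply: (half_connected_weak vM (M := M2)) => //.
- exact: (vertex_nonzero treeT).
- move=> g h g0 h0; apply: (conn_map (f := id) _ _ (HM2 g h g0 h0)) => // s.
  by rewrite map_id mem_cat orbC => ->.
Qed.

Lemma Sigma_of_vertices phi : realHom R G phi -> nonzero phi ->
  (forall e : edge GG, nonzero (fun c : egroup e => phi (eincl T c))) ->
  (forall v : vertex GG, Sigma R (vgroup v) (ray (fun g => phi (vincl T g)))) ->
  Sigma R G (ray phi).
Proof.
move=> phiM nz nze vS; apply/(SigmaP phiM); split=> //.
apply: half_of_vertices => // v.
by have /(SigmaP (realHom_vincl phiM (v := v)))[_] := vS v.
Qed.

Lemma Sigma_char : Sigma R G `<=` char_sphere R G.
Proof. by move=> _ [phi [phiM nz _] <-]; exists phi. Qed.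

Section EdgeCriterion.
Hypothesis crit : forall phi, realHom R G phi -> nonzero phi ->
  (Sigma R G (ray phi) <->
   forall e : edge GG, nonzero (fun c : egroup e => phi (eincl T c))).

Lemma Sigma_opp phi : Sigma R G (ray phi) -> Sigma R G (ray (fun x => - phi x)).
Proof.
move=> S; have /char_sphereP[phiM [x nz]] := Sigma_char S.
have nM : realHom R G (fun x => - phi x) by move=> y z; rewrite phiM opprD.
apply/crit => //; first by exists x; rewrite oppr_eq0.
have nz' : nonzero phi by exists x.
move=> e; have [c cP] := (crit phiM nz').1 S e; by exists c; rewrite oppr_eq0.
Qed.

Lemma Sigma_antipode : Sigma R G = antipode (Sigma R G).
Proof.
apply/seteqP; split=> [r Sr|_ [phi /= /Sigma_opp S <-//]].
have [phi _ rE] := Sigma_char Sr; exists (fun x => - phi x).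
  by apply: Sigma_opp; rewrite rE.
by rewrite -rE; congr ray; apply/funext => x; rewrite opprK.
Qed.

(** The criterion fails exactly when [phi] vanishes on some edge group; each edge contributes the
    sphere of the annihilator of its group. *)
Lemma Sigma_subspheres : finitely_generated G ->
  exists (n : nat) (X : 'I_n -> set (set (G -> R))),
    (forall i, rational_subsphere (X i)) /\
    Sigma R G = char_sphere R G `\` \bigcup_i X i.
Proof.
move=> fgG.
pose W (e : edge GG) := [set phi | realHom R G phi /\
  forall x, range (@eincl GG T e) x -> phi x = 0].
exists #|edge GG|, (fun i => subsphere (W (enum_val i))); split=> [i|].
  have [lW qW] := @annihilator_rat R G (range (@eincl GG T (enum_val i))) fgG.
  by exists (W (enum_val i)).
apply/seteqP; split=> [r Sr|_ [[phi [phiM nz] <-] nX]].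
  have Cr := Sigma_char Sr; split=> // -[i _ [psi [[psiM psi0] nz] rE]].
  move: Sr; rewrite -rE => /(crit psiM nz)/(_ (enum_val i))[c].
  by rewrite psi0 ?eqxx //; exists c.
apply/crit => // e; apply: contrapT => z; apply: nX.
exists (enum_rank e) => //; exists phi => //; split=> //.
rewrite enum_rankK; split=> // _ [c _ <-].
by apply: contrapT => /eqP cz; apply: z; exists c.
Qed.
End EdgeCriterion.
End Criterion.

Theorem theorem1p2 (R : realType) (GG : graph_of_groups)
    (T : {set edge GG}) :
  spanning_tree T ->
  reduced_graph GG ->
  not_ascending_HNN GG ->
  finitely_generated (pi1 T) ->
  ((forall e : edge GG, class_varsigma R (egroup e)) ->
    forall phi : pi1 T -> R, realHom R (pi1 T) phi -> nonzero phi ->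
      (Sigma R (pi1 T) (ray phi) <->
        (forall e : edge GG, nonzero (fun a : egroup e => phi (eincl T a))) /\
        (forall v : vertex GG,
          Sigma R (vgroup v) (ray (fun g : vgroup v => phi (vincl T g))))))
  /\
  ((forall v : vertex GG, class_varsigma R (vgroup v)) ->
    (forall phi : pi1 T -> R, realHom R (pi1 T) phi -> nonzero phi ->
      (Sigma R (pi1 T) (ray phi) <->
        forall e : edge GG, nonzero (fun a : egroup e => phi (eincl T a)))) /\
    Sigma R (pi1 T) = antipode (Sigma R (pi1 T)) /\
    exists (n : nat) (X : 'I_n -> set (set (pi1 T -> R))),
      (forall i, rational_subsphere (X i)) /\
      Sigma R (pi1 T) = char_sphere R (pi1 T) `\` \bigcup_i X i).
Proof.
move=> treeT redG nascG fgG.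
have nonzero_edges (phi : pi1 T -> R) : realHom R (pi1 T) phi ->
    Sigma R (pi1 T) (ray phi) ->
    forall e : edge GG, nonzero (fun a : egroup e => phi (eincl T a)).
  move=> phiM /(SigmaP phiM)[nz [S _ hS]].
  exact: (edge_nonzero treeT redG nascG phiM nz hS).
split=> [edgeS phi phiM nz|vertexS].
  split=> [Sphi|[nze vS]]; last exact: Sigma_of_vertices.
  have nze := nonzero_edges phi phiM Sphi.
  by split=> // v; apply: vertex_Sigma.
have crit (phi : pi1 T -> R) : realHom R (pi1 T) phi -> nonzero phi ->
    (Sigma R (pi1 T) (ray phi) <->
      forall e : edge GG, nonzero (fun a : egroup e => phi (eincl T a))).
  move=> phiM nz; split=> [|nze]; first exact: nonzero_edges.
  (* For a vertex group in varsigma it remains to see that the restriction is nonzero, which follows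
     from the edge groups by [vertex_nonzero]. *)
  apply: Sigma_of_vertices => // v; rewrite (vertexS v).2.
  apply/char_sphereP; split; first exact: realHom_vincl.
  exact: (vertex_nonzero treeT).
split=> //; split; first exact: Sigma_antipode.
exact: Sigma_subspheres.
Qed.
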